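(* Let $p,u,v,q$ be positive real numbers and let $$w_1(s)=\frac1\pi\left|\frac{\Gamma(p+is)\Gamma(u+is)\Gamma(v+is)}{\Gamma(2is)\Gamma(q+is)}\right|^2,\qquad s\ge 0 .$$ Then the finite system of Wilson polynomials $$p_n(p,u,v,1-q;s^2),\qquad n\ge 0 \text{ an integer with } 4n<q-p-u-v-1,$$ is orthogonal with respect to the weight $w_1$ on the half-line $s\ge0$; that is, for all nonnegative integers $n\neq m$ with $4n<q-p-u-v-1$ and $4m<q-p-u-v-1$, $$\int_0^\infty p_n(p,u,v,1-q;s^2)\,p_m(p,u,v,1-q;s^2)\,w_1(s)\,ds=0 .$$
   Context: $(x)_k=x(x+1)\cdots(x+k-1)$, $(x)_0=1$. The Wilson polynomials, as polynomials in $s^2$, are $$p_n(a,b,c,d;s^2)=(a+b)_n(a+c)_n(a+d)_n\;{}_4F_3\!\left[\begin{matrix}-n,\ n+a+b+c+d-1,\ a+is,\ a-is\\ a+b,\ a+c,\ a+d\end{matrix};1\right],$$ i.e. $$p_n(a,b,c,d;s^2)=\sum_{k=0}^n\frac{(-n)_k(n+a+b+c+d-1)_k(a+is)_k(a-is)_k}{k!}\,(a+b+k)_{n-k}(a+c+k)_{n-k}(a+d+k)_{n-k}.$$ The factor $1/\Gamma(2is)$ is understood as $0$ at $s=0$. *)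

(* Defs.v *)
From HB Require Import structures.
From mathcomp Require Import all_boot all_order all_algebra.
From mathcomp Require Import all_classical all_reals all_analysis.
From mathcomp Require Import complex.

Set Implicit Arguments.
Unset Strict Implicit.
Unset Printing Implicit Defensive.
Import Order.TTheory GRing.Theory Num.Theory.
Import numFieldNormedType.Exports.

Local Open Scope classical_set_scope.
Local Open Scope complex_scope.
Local Open Scope ring_scope.

(* (x)_k *)
Definition poch (F : pzRingType) (x : F) (k : nat) : F :=
  \prod_(j < k) (x + j%:R).

(* The parameters are complex numbers. The hypergeometric series is written
   with its denominators a+b, a+c, a+d cleared, so that the definition also
   makes sense when one of them is a nonpositive integer. *)
Definition wilson (R : realType) (n : nat) (a b c d : R[i]) (s : R) : R[i] :=
  \sum_(k < n.+1)
    poch (- n%:R) k * poch (n%:R + a + b + c + d - 1) k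
      * poch (a + s*i) k * poch (a - s*i) k / (k`!)%:R
      * (poch (a + b + k%:R) (n - k) * poch (a + c + k%:R) (n - k)
         * poch (a + d + k%:R) (n - k)).

Definition cexp (R : realType) (z : R[i]) : R[i] :=
  (expR (complex.Re z))%:C * (cos (complex.Im z) +i* sin (complex.Im z)).

(* Euler's limit n! n^z / (z (z+1) ... (z+n)), which converges to Gamma(z)
   for every complex z that is not a pole (in particular on the imaginary
   axis without 0, where the integral of t^(z-1) e^(-t) does not converge).
   At the poles the value carries no meaning. *)
Definition Gamma (R : realType) (z : R[i]) : R[i] :=
  limn (fun n => (n`!)%:R * cexp (z * (ln n%:R)%:C) / poch z n.+1 : R[i]^o).

(* 1 / Gamma(2is), with the value 0 at s = 0 *)
Definition invGamma2i (R : realType) (s : R) : R[i] :=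
  if s == 0 then 0 else (Gamma ((2 * s)*i))^-1.

Definition w1 (R : realType) (p u v q s : R) : R :=
  pi^-1 *
  (ComplexField.Normc.normc
     (Gamma (p%:C + s*i) * Gamma (u%:C + s*i) * Gamma (v%:C + s*i)
        * invGamma2i s / Gamma (q%:C + s*i))) ^+ 2.

Definition cintegrable (R : realType) (D : set R) (f : R -> R[i]) : Prop :=
  lebesgue_measure.-integrable D (fun s => (complex.Re (f s))%:E) /\
  lebesgue_measure.-integrable D (fun s => (complex.Im (f s))%:E).

(* Both components are 0 by convention when the extended integral is
   infinite; meaningful together with cintegrable. *)
Definition cintegral (R : realType) (D : set R) (f : R -> R[i]) : R[i] :=
  (\int[lebesgue_measure]_(s in D) complex.Re (f s))
    +i* (\int[lebesgue_measure]_(s in D) complex.Im (f s)).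

(* Main.v *)
Require Import Defs.
From HB Require Import structures.
From mathcomp Require Import all_boot all_order all_algebra.
From mathcomp Require Import all_classical all_reals all_analysis.
From mathcomp Require Import measurable_realfun complex ring lra.

Set Implicit Arguments.
Unset Strict Implicit.
Unset Printing Implicit Defensive.
Import Order.TTheory GRing.Theory Num.Theory.
Import numFieldNormedType.Exports.

Local Open Scope classical_set_scope.
Local Open Scope complex_scope.
Local Open Scope ring_scope.

(** Since [|Gamma(a + is)|^2] is a constant divided by the infinite product
    [glim a s] of the factors [1 + s^2/(a + j)^2], the weight is a constant
    multiple of
    [weight p u v q s = s^2 g(1) g(1/2) g(q) / (g(p) g(u) g(v))]
    ([w1_weight]; the duplication formula turns [1/Gamma(2is)] into [g(1)] and
    [g(1/2)]). Multiplying it by [(p^2 + s^2) ... ((p + i - 1)^2 + s^2)] and by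
    the analogous product with [u] replaces [p] and [u] by [p + i] and [u + j],
    up to a constant.

    Everything rests on one linear relation ([integral_weight_moment]), which
    says that the degree-one Wilson polynomial is orthogonal to the constants.
    With [z = is], the weight times this polynomial is, up to a constant, the
    difference [om(z + 1/2) - om(z - 1/2)] for an odd function [om], holomorphic
    on [|Re z| <= 1/2]: the weight divided by [z], with the parameters [p], [u],
    [v], [1 - q] raised by one half. A contour shift makes its integral vanish.
    The shift is performed on the rational functions obtained by truncating the
    products, where holomorphy and decay are elementary ([half_strip_shift],
    [integral_half_weight_eq0]): the half-line integral of the real part at
    abscissa [1/2] equals the one at abscissa [0], where [om] is purely
    imaginary. Truncating the product of [q] earlier than the others gives a
    bound independent of the truncation ([trunc_weight_le]), so that dominated
    convergence applies.

    Applied to the shifted parameters, the relation is a first-order recurrence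
    for the moments [moment p u v q i j] of the products above. Expanding one
    polynomial in the products attached to [p], and the other, of smaller
    degree, in those attached to [u], reduces orthogonality to the vanishing
    of a terminating balanced sum, which is a finite difference of order [n]
    of a polynomial of degree [n - 1] ([saalschutz_zero]). *)

Local Notation Re := complex.Re.
Local Notation Im := complex.Im.
Local Notation normc := ComplexField.Normc.normc.

(** * Integrals over the half-line and Cauchy's theorem for a half strip *)

Section HalfLine.
Variable R : realType.
Notation mu := (@lebesgue_measure R).
Implicit Types (f F : R -> R) (C : R).

Lemma oneDsqr_gt0 (s : R) : 0 < oneDsqr s.
Proof. by rewrite (lt_le_trans ltr01)// oneDsqr_ge1. Qed.

Lemma integrable_oneDsqrV C :
  mu.-integrable `[0, +oo[ (EFin \o (fun s => C * (oneDsqr s)^-1)).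
Proof.
have mD : measurable (`[0, +oo[%classic : set R) by exact: measurable_itv.
rewrite (_ : _ \o _ = fun s => (C%:E * ((oneDsqr s)^-1)%:E)%E); last first.
  by apply/funext => s /=; rewrite EFinM.
apply: integrableZl => //.
apply/integrableP; split.
  apply/measurable_EFinP/measurable_funTS.
  by apply: continuous_measurable_fun; exact: continuous_oneDsqrV.
under eq_integral do rewrite gee0_abs ?lee_fin ?invr_ge0//.
by rewrite integral0y_oneDsqr ltry.
Qed.

Lemma integrable_quadratic_decay f C :
    measurable_fun (`[0, +oo[%classic : set R) f ->
    (forall s, 0 <= s -> `|f s| <= C * (oneDsqr s)^-1) ->
  mu.-integrable `[0, +oo[ (EFin \o f).
Proof.
move=> mf f_le.
apply: (le_integrable _ _ _ (integrable_oneDsqrV C)).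
- exact: measurable_itv.
- exact/measurable_EFinP.
- move=> s /=; rewrite in_itv/= andbT => s0; rewrite lee_fin.
  by rewrite (le_trans (f_le s s0))// ler_norm.
Qed.

Lemma Rintegral_oneDsqrV C :
  \int[mu]_(s in `[0, +oo[) (C * (oneDsqr s)^-1) = C * (pi / 2).
Proof.
rewrite RintegralZl//.
- by rewrite /Rintegral integral0y_oneDsqr.
- have := integrable_oneDsqrV 1.
  by under [X in _.-integrable _ X]eq_fun do rewrite /= mul1r.
Qed.

(** Adding a multiple of the derivative of the arctangent makes the integrand
    nonnegative, which reduces the statement to the monotone case. *)
Lemma FTC2y_quadratic_decay f F C (l : R) :
    continuous f ->
    (forall s : R, is_derive s 1 F (f s)) ->
    (forall s, 0 <= s -> `|f s| <= C * (oneDsqr s)^-1) ->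
    F x @[x --> +oo] --> l ->
  \int[mu]_(s in `[0, +oo[) f s = l - F 0.
Proof.
move=> cf dF f_le Fl.
have mD : measurable (`[0, +oo[%classic : set R) by exact: measurable_itv.
have If : mu.-integrable `[0, +oo[ (EFin \o f).
  apply: (integrable_quadratic_decay _ f_le).
  by apply: measurable_funTS; exact: continuous_measurable_fun.
pose g s := f s + C * (oneDsqr s)^-1.
pose G s := F s + C * atan s.
have cg : continuous g.
  move=> s; apply: cvgD; first exact: cf.
  by apply: cvgMl_tmp; exact: continuous_oneDsqrV.
have dG (s : R) : is_derive s 1 G (g s).
  by apply: is_deriveD; rewrite /oneDsqr; apply: is_deriveZ.
have dcG s : {for s, continuous G}.
  by apply: differentiable_continuous; apply/derivable1_diffP.
have : \int[mu]_(s in `[0, +oo[) g s = (l + C * (pi / 2)) - G 0.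
  apply: Rintegral_ge0_continuous_FTC2y => //.
  - move=> s s0; rewrite /g -lerBlDr sub0r.
    by have := f_le _ s0; rewrite ler_norml => /andP[].
  - by apply: continuous_subspaceT.
  - by apply: cvgD => //; apply: cvgMl_tmp; exact: cvgy_atan.
  - by apply: cvg_at_right_filter; exact: dcG.
  - by move=> s _; rewrite derive1E; exact: derive_val.
rewrite RintegralD//; last exact: integrable_oneDsqrV.
rewrite Rintegral_oneDsqrV /G atan0 mulr0 addr0 => /(congr1 (fun x => x - C * (pi / 2))).
by rewrite addrK => ->; ring.
Qed.

Lemma cvgy_oneDsqrV C : C * (oneDsqr s)^-1 @[s --> +oo] --> (0 : R).
Proof.
rewrite -[0](mulr0 C); apply: cvgMl_tmp.
apply/cvgrPdist_le => e e0; near=> s.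
have s1 : 1 <= s by near: s; apply: nbhs_pinfty_ge; exact: num_real.
have s2 : e^-1 <= s by near: s; apply: nbhs_pinfty_ge; exact: num_real.
rewrite sub0r normrN ger0_norm ?invr_ge0//.
rewrite -[e]invrK lef_pV2 ?posrE ?invr_gt0 ?oneDsqr_gt0//.
rewrite /oneDsqr; nra.
Unshelve. all: by end_near. Qed.

(** Cauchy's theorem for a half strip, in real form: [U + iV] is holomorphic
    at [x + is], with derivative of real part [U1], so that the integral of [U]
    along the half-line of abscissa [x] has derivative the integral of
    [dU/dx = dV/ds], that is the limit of [V] minus its value on the real
    axis, both zero. *)
Lemma half_strip_shift (U V U1 : R -> R -> R) (r C : R) :
    2^-1 < r ->
    (forall x s : R, `|x| < r -> is_derive x 1 (U ^~ s) (U1 x s)) ->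
    (forall x s : R, `|x| < r -> is_derive s 1 (V x) (U1 x s)) ->
    (forall x, `|x| < r -> continuous (U x)) ->
    (forall x, `|x| < r -> continuous (U1 x)) ->
    (forall x s, `|x| < r -> `|U x s| <= C * (oneDsqr s)^-1) ->
    (forall x s, `|x| < r -> `|V x s| <= C * (oneDsqr s)^-1) ->
    (forall x s, `|x| < r -> `|U1 x s| <= C * (oneDsqr s)^-1) ->
    (forall x, V x 0 = 0) ->
    (forall s, U 0 s = 0) ->
  \int[mu]_(s in `[0, +oo[) U 2^-1 s = 0.
Proof.
move=> r2 dU dV cU cU1 bU bV bU1 V0 U0.
have mD : measurable (`[0, +oo[%classic : set R) by exact: measurable_itv.
have IU x : `|x| < r -> mu.-integrable `[0, +oo[ (EFin \o U x).
  move=> xr; apply: (@integrable_quadratic_decay _ C) => [|s _]; last exact: bU.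
  apply: measurable_funTS; apply: continuous_measurable_fun.
  exact: cU.
have intU1 x : `|x| < r -> \int[mu]_(s in `[0, +oo[) U1 x s = 0.
  move=> xr; have Vl : V x s @[s --> +oo] --> 0.
    apply: (@squeeze_cvgr _ _ _ _ (fun s => - (C * (oneDsqr s)^-1))
                                  (fun s => C * (oneDsqr s)^-1)).
    - by apply: nearW => s; rewrite -ler_norml; exact: bV.
    - by rewrite -[0]oppr0; apply: cvgN; exact: cvgy_oneDsqrV.
    - exact: cvgy_oneDsqrV.
  have := FTC2y_quadratic_decay (cU1 x xr) (fun s => dV x s xr)
    (fun s _ => bU1 x s xr) Vl.
  by rewrite V0 subr0.
pose J x := \int[mu]_(s in `[0, +oo[) U x s.
have dJ (x : R) : `|x| < r -> is_derive x 1 J 0.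
  move=> xr.
  have d1E y s : `|y| < r -> partial1of2 U y s = U1 y s.
    move=> yr; rewrite partial1of2E; have ? := dU _ s yr; exact: derive_val.
  have xI : `](- r), r[%classic x by rewrite /= in_itv/= -ltr_norml.
  have IE y : `](- r), r[%classic y -> `|y| < r by rewrite /= in_itv/= -ltr_norml.
  have H1 y : `](- r), r[%classic y -> mu.-integrable `[0, +oo[ (EFin \o U y).
    by move=> /IE; exact: IU.
  have H2 y s : `](- r), r[%classic y -> `[0, +oo[%classic s -> derivable (U ^~ s) y 1.
    by move=> /IE yr _; have ? := dU _ s yr; exact: ex_derive.
  have H3 y s : `](- r), r[%classic y -> `[0, +oo[%classic s -> 
      `|partial1of2 U y s| <= `|C| * (oneDsqr s)^-1.
    move=> /IE yr _; rewrite d1E// (le_trans (bU1 _ s yr))//.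
    by rewrite ler_wpM2r ?invr_ge0// ler_norm.
  have H0 s : 0 <= `|C| * (oneDsqr s)^-1 by rewrite mulr_ge0// invr_ge0.
  apply: DeriveDef.
    exact: (@derivable_under_integral _ _ _ mu _ _ mD _ _ _ xI H1 H2 _ H0
      (integrable_oneDsqrV `|C|) H3).
  rewrite -derive1E.
  rewrite (@differentiation_under_integral _ _ _ mu _ _ mD _ _ _ xI H1 H2 _ H0
    (integrable_oneDsqrV `|C|) H3).
  by under eq_Rintegral do rewrite d1E//; exact: intU1.
have half_ge0 : 0 <= 2^-1 :> R by rewrite invr_ge0.
have inr x : x \in `[0, 2^-1] -> `|x| < r.
  by rewrite in_itv/= => /andP[x0 x2]; rewrite ger0_norm// (le_lt_trans x2).
have [||c _] := @MVT_segment _ J (cst 0) 0 2^-1 half_ge0.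
- by move=> x xI; apply/dJ/inr; move: x xI; apply: subset_itv_oo_cc.
- by apply: derivable_within_continuous => x /inr/dJ ?; exact: ex_derive.
rewrite mul0r => /eqP; rewrite subr_eq0 => /eqP JE; apply: (etrans JE).
by rewrite /J; under eq_Rintegral do rewrite U0; rewrite Rintegral_cst// mul0r.
Qed.

End HalfLine.

(** * Holomorphic functions on a vertical strip *)

Section ComplexArith.
Variable R : realType.
Implicit Types z w : R[i].

Lemma Re_mul z w : Re (z * w) = Re z * Re w - Im z * Im w.
Proof. by case: z w => [a b] [c d]. Qed.

Lemma Im_mul z w : Im (z * w) = Re z * Im w + Im z * Re w.
Proof. by case: z w => [a b] [c d]. Qed.

Lemma Re_add z w : Re (z + w) = Re z + Re w.
Proof. by case: z w => [a b] [c d]. Qed.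

Lemma Im_add z w : Im (z + w) = Im z + Im w.
Proof. by case: z w => [a b] [c d]. Qed.

Lemma Re_opp z : Re (- z) = - Re z.
Proof. by case: z. Qed.

Lemma Im_opp z : Im (- z) = - Im z.
Proof. by case: z. Qed.

Lemma Re_inv z : Re z^-1 = Re z / (Re z ^+ 2 + Im z ^+ 2).
Proof. by case: z. Qed.

Lemma Im_inv z : Im z^-1 = - Im z / (Re z ^+ 2 + Im z ^+ 2).
Proof. by case: z => a b /=; rewrite mulNr. Qed.

Lemma normcE2 z : normc z = Num.sqrt (Re z ^+ 2 + Im z ^+ 2).
Proof. by case: z. Qed.

Lemma sqr_normc2 z : normc z ^+ 2 = Re z ^+ 2 + Im z ^+ 2.
Proof. by rewrite normcE2 sqr_sqrtr// addr_ge0// sqr_ge0. Qed.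

Lemma normc_ge0 z : 0 <= normc z.
Proof. by rewrite normcE2 sqrtr_ge0. Qed.

Lemma Re_le_normc z : `|Re z| <= normc z.
Proof. by rewrite normcE2 -sqrtr_sqr ler_wsqrtr// lerDl sqr_ge0. Qed.

Lemma Im_le_normc z : `|Im z| <= normc z.
Proof. by rewrite normcE2 -sqrtr_sqr ler_wsqrtr// lerDr sqr_ge0. Qed.

Lemma normc_le_ReIm z : normc z <= `|Re z| + `|Im z|.
Proof.
rewrite -(@ler_pXn2r _ 2)// ?nnegrE ?normc_ge0 ?addr_ge0//.
rewrite sqr_normc2 sqrrD !real_normK ?num_real//.
by rewrite lerD2r lerDl mulrn_wge0// mulr_ge0.
Qed.

Lemma normc_real (x : R) : normc x%:C = `|x|.
Proof. by rewrite normcE2 /= expr0n addr0 sqrtr_sqr. Qed.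

Lemma sumsq_eq0 z : (Re z ^+ 2 + Im z ^+ 2 == 0) = (z == 0).
Proof.
rewrite paddr_eq0 ?sqr_ge0// !sqrf_eq0.
by case: z => a b; rewrite eq_complex.
Qed.

End ComplexArith.

Section ComplexDerivative.
Variable R : realType.
Implicit Types (h k : R -> R[i]) (t : R) (d e : R[i]).
Local Notation re h := (fun u : R => Re (h u)).
Local Notation im h := (fun u : R => Im (h u)).

(** Derivative of a complex-valued function of a real variable, through its
    components; holomorphy is expressed by derivatives along horizontal and
    vertical lines. *)
Definition is_cderive h t d :=
  is_derive t 1 (re h) (Re d) /\ is_derive t 1 (im h) (Im d).

Lemma is_cderive_cst c t : is_cderive (fun=> c) t 0.
Proof. by split; exact: is_derive_cst. Qed.

Lemma is_cderiveD h k t d e : is_cderive h t d -> is_cderive k t e ->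
  is_cderive (fun t => h t + k t) t (d + e).
Proof.
move=> [h1 h2] [k1 k2]; split.
  rewrite (_ : (fun u => Re (h u + k u)) = re h + re k); last first.
    by apply/funext => u /=; rewrite Re_add.
  by rewrite Re_add; exact: is_deriveD.
rewrite (_ : (fun u => Im (h u + k u)) = im h + im k); last first.
  by apply/funext => u /=; rewrite Im_add.
by rewrite Im_add; exact: is_deriveD.
Qed.

Lemma is_cderiveM h k t d e : is_cderive h t d -> is_cderive k t e ->
  is_cderive (fun t => h t * k t) t (d * k t + h t * e).
Proof.
move=> [h1 h2] [k1 k2]; split.
  rewrite (_ : (fun u => Re (h u * k u)) = re h * re k - im h * im k); last first.
    by apply/funext => u /=; rewrite Re_mul.
  apply: (is_derive_eq (is_deriveB (is_deriveM h1 k1) (is_deriveM h2 k2))).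
  by rewrite Re_add !Re_mul /GRing.scale/=; ring.
rewrite (_ : (fun u => Im (h u * k u)) = re h * im k + im h * re k); last first.
  by apply/funext => u /=; rewrite Im_mul.
apply: (is_derive_eq (is_deriveD (is_deriveM h1 k2) (is_deriveM h2 k1))).
by rewrite Im_add !Im_mul /GRing.scale/=; ring.
Qed.

Lemma is_cderiveV h t d : h t != 0 -> is_cderive h t d ->
  is_cderive (fun t => (h t)^-1) t (- d / h t ^+ 2).
Proof.
move=> ht0 [h1 h2].
pose g := re h * re h + im h * im h.
have gE u : g u = Re (h u) ^+ 2 + Im (h u) ^+ 2 by rewrite /g !expr2.
have gt0 : g t != 0 by rewrite gE sumsq_eq0.
have dg : is_derive t 1 g (2 * (Re (h t) * Re d + Im (h t) * Im d)).
  by apply: (is_derive_eq (is_deriveD (is_deriveM h1 h1) (is_deriveM h2 h2)));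
    rewrite /GRing.scale/=; ring.
have dgV := is_deriveV gt0 dg.
move: (gt0); rewrite gE => gt0'.
rewrite expr2 invfM mulrA.
split.
  rewrite (_ : (fun u => Re ((h u)^-1)) = re h * (fun u => (g u)^-1)); last first.
    by apply/funext => u /=; rewrite Re_inv -gE.
  apply: is_derive_eq.
  rewrite !(Re_mul, Re_inv, Im_inv, Re_opp, Im_opp, Im_mul) gE/= /GRing.scale/=.
  by move: gt0'; set a := Re (h t); set b := Im (h t) => gt0'; field.
rewrite (_ : (fun u => Im ((h u)^-1)) = - (im h * (fun u => (g u)^-1))); last first.
  by apply/funext => u /=; rewrite Im_inv -gE mulNr.
apply: is_derive_eq.
rewrite !(Re_mul, Re_inv, Im_inv, Re_opp, Im_opp, Im_mul) gE/= /GRing.scale/=.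
by move: gt0'; set a := Re (h t); set b := Im (h t) => gt0'; field.
Qed.

Lemma is_cderive_continuous h t d : is_cderive h t d ->
  {for t, continuous (re h)} /\ {for t, continuous (im h)}.
Proof.
by move=> [h1 h2]; split; apply: differentiable_continuous; apply/derivable1_diffP.
Qed.

End ComplexDerivative.

Section Strip.
Variables (R : realType) (r : R).
Implicit Types f g df dg : R[i] -> R[i].

(** Functions holomorphic on the strip of half-width [r] which, together with
    their derivative, decay at least like the inverse [k]-th power of the
    height. *)
Definition strip_hol (k : nat) f df :=
  [/\ forall x s : R, `|x| < r ->
        is_cderive (fun u => f (u +i* s)) x (df (x +i* s)) /\
        is_cderive (fun u => f (x +i* u)) s ('i * df (x +i* s)),
      forall x : R, `|x| < r ->
        continuous (fun s : R => Re (df (x +i* s))) /\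
        continuous (fun s : R => Im (df (x +i* s)))
    & exists C : R, forall x s : R, `|x| < r ->
        normc (f (x +i* s)) <= C / Num.sqrt (oneDsqr s) ^+ k /\
        normc (df (x +i* s)) <= C / Num.sqrt (oneDsqr s) ^+ k].

Lemma sqrt_oneDsqr_ge1 (s : R) : 1 <= Num.sqrt (oneDsqr s).
Proof. by rewrite -[leLHS]sqrtr1 ler_wsqrtr// oneDsqr_ge1. Qed.

Lemma strip_hol_weaken k f df : strip_hol k.+1 f df -> strip_hol k f df.
Proof.
move=> [h1 h2 [C hC]]; split => //; exists `|C| => x s xr.
have [b1 b2] := hC x s xr.
have s1 := sqrt_oneDsqr_ge1 s.
have s0 : 0 < Num.sqrt (oneDsqr s) by rewrite (lt_le_trans ltr01).
have le : C / Num.sqrt (oneDsqr s) ^+ k.+1 <= `|C| / Num.sqrt (oneDsqr s) ^+ k.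
  apply: (@le_trans _ _ (`|C| / Num.sqrt (oneDsqr s) ^+ k.+1)).
    by rewrite ler_wpM2r ?ler_norm// invr_ge0 exprn_ge0 ?ltW.
  rewrite ler_wpM2l// lef_pV2 ?posrE ?exprn_gt0//.
  by rewrite exprS ler_peMl// exprn_ge0 ?ltW.
by split; apply: le_trans le.
Qed.

Lemma strip_hol_continuous k f df : strip_hol k f df ->
  forall x : R, `|x| < r ->
    continuous (fun s : R => Re (f (x +i* s))) /\
    continuous (fun s : R => Im (f (x +i* s))).
Proof.
by move=> [h _ _] x xr; split=> s; have [_ /is_cderive_continuous[]] := h x s xr.
Qed.

Lemma strip_holD k f g df dg : strip_hol k f df -> strip_hol k g dg ->
  strip_hol k (fun z => f z + g z) (fun z => df z + dg z).
Proof.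
move=> [f1 f2 [C fC]] [g1 g2 [D gD]]; split.
- move=> x s xr; have [fx fs] := f1 x s xr; have [gx gs] := g1 x s xr.
  split; first exact: is_cderiveD.
  by rewrite mulrDr; exact: is_cderiveD.
- move=> x xr; have [fR fI] := f2 x xr; have [gR gI] := g2 x xr.
  split.
  + under eq_fun do rewrite Re_add.
    by move=> s; apply: cvgD; [exact: fR|exact: gR].
  + under eq_fun do rewrite Im_add.
    by move=> s; apply: cvgD; [exact: fI|exact: gI].
- exists (C + D) => x s xr; have [a1 a2] := fC x s xr; have [b1 b2] := gD x s xr.
  by rewrite mulrDl; split; apply: (le_trans (le_normcD _ _)); apply: lerD.
Qed.

Lemma strip_holM k l f g df dg : strip_hol k f df -> strip_hol l g dg ->
  strip_hol (k + l) (fun z => f z * g z) (fun z => df z * g z + f z * dg z).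
Proof.
move=> hf hg; have cf := strip_hol_continuous hf; have cg := strip_hol_continuous hg.
move: hf hg => [f1 f2 [C fC]] [g1 g2 [D gD]]; split.
- move=> x s xr; have [fx fs] := f1 x s xr; have [gx gs] := g1 x s xr.
  split; first exact: is_cderiveM.
  by rewrite mulrDr mulrA (mulrCA 'i); exact: is_cderiveM.
- move=> x xr; have [fR fI] := f2 x xr; have [gR gI] := g2 x xr.
  have [cfR cfI] := cf x xr; have [cgR cgI] := cg x xr.
  split.
  + under eq_fun do rewrite Re_add !Re_mul.
    by move=> s; apply: cvgD; apply: cvgB; apply: cvgM;
      first [exact: fR|exact: fI|exact: gR|exact: gI
            |exact: cfR|exact: cfI|exact: cgR|exact: cgI].
  + under eq_fun do rewrite Im_add !Im_mul.
    by move=> s; apply: cvgD; apply: cvgD; apply: cvgM;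
      first [exact: fR|exact: fI|exact: gR|exact: gI
            |exact: cfR|exact: cfI|exact: cgR|exact: cgI].
- exists (C * D + C * D) => x s xr.
  have [a1 a2] := fC x s xr; have [b1 b2] := gD x s xr.
  set w := Num.sqrt (oneDsqr s) in a1 a2 b1 b2 *.
  have w1 : 1 <= w by exact: sqrt_oneDsqr_ge1.
  have w0 : 0 < w by rewrite (lt_le_trans ltr01).
  have E : C * D / w ^+ (k + l) = (C / w ^+ k) * (D / w ^+ l).
    by rewrite exprD invfM; ring.
  have P y z : normc y <= C / w ^+ k -> normc z <= D / w ^+ l ->
      normc (y * z) <= C * D / w ^+ (k + l).
    by move=> hy hz; rewrite E ComplexField.Normc.normcM ler_pM// normc_ge0.
  split.
    apply: (le_trans (P _ _ a1 b1)); rewrite mulrDl lerDl.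
    by apply: le_trans (P _ _ a1 b1); exact: normc_ge0.
  rewrite mulrDl; apply: (le_trans (le_normcD _ _)).
  by apply: lerD; apply: P.
Qed.

Lemma strip_hol_cst c : strip_hol 0 (fun=> c) (fun=> 0).
Proof.
split.
- by move=> x s _; rewrite mulr0; split; exact: is_cderive_cst.
- by move=> x _; split; exact: cst_continuous.
- exists (normc c) => x s _; rewrite expr0 divr1; split => //.
  by rewrite ComplexField.Normc.normc0 normc_ge0.
Qed.

End Strip.

Section StripRational.
Variables (R : realType) (r : R).
Implicit Types (f g : R[i] -> R[i]) (z : R[i]) (a b : R).

Definition decays k f := exists df, strip_hol r k f df.

(** Quotients of polynomials can be rearranged freely where no denominator
    vanishes: the strip is open, so derivatives only see values there. *)
Lemma eq_decays k f g : (forall z, `|Re z| < r -> f z = g z) ->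
  decays k f -> decays k g.
Proof.
move=> fg [df [h1 h2 [C hC]]]; exists df; split => //.
  move=> x s xr; have [[fx1 fx2] [fs1 fs2]] := h1 x s xr.
  have near_r : \forall u \near x, `|u| < r.
    have : {for x, continuous (fun u : R => `|u|)} by exact: norm_continuous.
    by move/cvgr_lt; apply.
  split; split.
  - apply: near_eq_is_derive fx1; near=> u; congr Re; apply: fg => /=.
    by near: u.
  - apply: near_eq_is_derive fx2; near=> u; congr Im; apply: fg => /=.
    by near: u.
  - by apply: near_eq_is_derive fs1; near=> u; rewrite fg.
  - by apply: near_eq_is_derive fs2; near=> u; rewrite fg.
by exists C => x s xr; rewrite -fg//; exact: hC.
Unshelve. all: by end_near. Qed.

Lemma decays_weaken k f : decays k.+1 f -> decays k f.
Proof. by move=> [df /strip_hol_weaken ?]; exists df. Qed.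

Lemma decays_bounded k f : decays k f -> decays 0 f.
Proof. by elim: k => // k IH /decays_weaken. Qed.

Lemma decaysD k f g : decays k f -> decays k g -> decays k (fun z => f z + g z).
Proof. by move=> [df hf] [dg hg]; eexists; exact: strip_holD hf hg. Qed.

Lemma decaysM k l f g : decays k f -> decays l g ->
  decays (k + l) (fun z => f z * g z).
Proof. by move=> [df hf] [dg hg]; eexists; exact: strip_holM hf hg. Qed.

Lemma decays_cst c : decays 0 (fun=> c).
Proof. by exists (fun=> 0); exact: strip_hol_cst. Qed.

Lemma decaysZ k c f : decays k f -> decays k (fun z => c * f z).
Proof. by move=> hf; have := decaysM (decays_cst c) hf. Qed.

Lemma is_cderive_line (e : R) x s :
  is_cderive (fun u => e%:C * (u +i* s)) x e%:C /\
  is_cderive (fun u => e%:C * (x +i* u)) s ('i * e%:C).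
Proof.
by split; split; rewrite /= ?(mul0r, mul1r, mulr0, mulr1, subr0, add0r, addr0);
   under eq_fun do rewrite ?(mul0r, subr0, addr0); rewrite ?oppr0;
   apply: is_derive_eq; rewrite /GRing.scale/= ?mulr1 ?mul0r ?mulr0 ?addr0.
Qed.

Lemma linear_neq0 (e b : R) z : e ^+ 2 = 1 -> r < b -> `|Re z| < r ->
  b%:C + e%:C * z != 0.
Proof.
move=> e1 rb; case: z => x s /=; rewrite ltr_norml => /andP[x1 x2].
rewrite eq_complex /= negb_and; apply/orP; left.
have : (e - 1) * (e + 1) = 0 by rewrite -subr_sqr e1 expr1n subrr.
move=> /eqP; rewrite mulf_eq0 subr_eq0 addr_eq0 => /orP[/eqP ->|/eqP ->].
  by rewrite gt_eqF//; lra.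
by rewrite gt_eqF//; lra.
Qed.

Lemma decays_invlinear (e b : R) : e ^+ 2 = 1 -> r < b ->
  decays 1 (fun z => (b%:C + e%:C * z)^-1).
Proof.
move=> e1 rb; have e1' : e = 1 \/ e = -1.
  have : (e - 1) * (e + 1) = 0 by rewrite -subr_sqr e1 expr1n subrr.
  move=> /eqP; rewrite mulf_eq0 subr_eq0 addr_eq0.
  by move=> /orP[/eqP ->|/eqP ->]; [left|right].
exists (fun z => - e%:C / (b%:C + e%:C * z) ^+ 2); split.
- move=> x s xr; have nz := @linear_neq0 e b (x +i* s) e1 rb xr.
  have [dx ds] := is_cderive_line e x s.
  have cb t : is_cderive (fun _ : R => b%:C) t 0 by exact: is_cderive_cst.
  split.
    have := is_cderiveV nz (is_cderiveD (cb x) dx).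
    by rewrite add0r.
  have := is_cderiveV nz (is_cderiveD (cb s) ds).
  by rewrite add0r mulrA mulrN.
- move=> x xr.
  suff H s : {for s, continuous (fun s => Re (- e%:C / (b%:C + e%:C * (x +i* s)) ^+ 2))} /\
             {for s, continuous (fun s => Im (- e%:C / (b%:C + e%:C * (x +i* s)) ^+ 2))}.
    by split=> s; have [] := H s.
  have nz := @linear_neq0 e b (x +i* s) e1 rb xr.
  have [_ ds] := is_cderive_line e x s.
  have cb c t : is_cderive (fun _ : R => c) t 0 by exact: is_cderive_cst.
  have dV := is_cderiveV nz (is_cderiveD (cb b%:C s) ds).
  have dd := is_cderiveM (cb (- e%:C) s) (is_cderiveM dV dV).
  apply: (@is_cderive_continuous _ (fun u => - e%:C / (b%:C + e%:C * (x +i* u)) ^+ 2)).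
  by under eq_fun do rewrite expr2 invfM; exact: dd.
(* On the strip, [m * sqrt(1 + s^2)] is a lower bound of [|b + e z|]. *)
pose m := Num.min 1 (b - r).
have m0 : 0 < m by rewrite lt_min ltr01 subr_gt0.
exists (m ^- 2) => x s xr.
have w1 := sqrt_oneDsqr_ge1 s; set w := Num.sqrt (oneDsqr s) in w1 *.
have w0 : 0 < w by rewrite (lt_le_trans ltr01).
have w2 : w ^+ 2 = 1 + s ^+ 2 by rewrite sqr_sqrtr// (le_trans ler01)// oneDsqr_ge1.
have m1 : m <= 1 by rewrite ge_min lexx.
have mb : m <= b - r by rewrite ge_min lexx orbT.
have lb : m * w <= normc (b%:C + e%:C * (x +i* s)).
  have mw0 : 0 <= m * w by rewrite mulr_ge0// ltW.
  rewrite -(@ler_pXn2r _ 2)// ?nnegrE ?normc_ge0//.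
  rewrite sqr_normc2 exprMn w2 /= !mul0r subr0 add0r addr0 exprMn e1 mul1r mulrDr mulr1.
  have x1 : m <= b + e * x.
    move: xr; rewrite ltr_norml => /andP[? ?].
    by case: e1' => ->; lra.
  apply: lerD.
    by rewrite ler_pXn2r// nnegrE ltW// (lt_le_trans m0).
  by rewrite ler_piMl ?sqr_ge0// expr_le1 ?(ltW m0).
have ub : normc (b%:C + e%:C * (x +i* s))^-1 <= m^-1 / w.
  rewrite ComplexField.Normc.normcV -invfM lef_pV2 ?posrE ?mulr_gt0//.
  by rewrite (lt_le_trans _ lb)// mulr_gt0.
have mV1 : 1 <= m^-1 by rewrite invf_ge1.
rewrite expr1; split.
  apply: (le_trans ub); rewrite ler_wpM2r ?invr_ge0 ?(ltW w0)// expr2 invfM.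
  by rewrite ler_peMl// ltW// invr_gt0.
rewrite expr2 invfM !ComplexField.Normc.normcM.
have -> : normc (- e%:C) = 1.
  by case: e1' => ->; rewrite /= ?oppr0 expr0n addr0 ?sqrrN ?expr1n ?sqrtr1// opprK expr1n sqrtr1.
rewrite mul1r; apply: (@le_trans _ _ ((m^-1 / w) * (m^-1 / w))).
  by apply: ler_pM; rewrite ?normc_ge0.
rewrite [leLHS](_ : _ = (m ^- 2 / w) * w^-1); last by rewrite expr2 !invfM; ring.
by rewrite ler_piMr ?invf_le1// divr_ge0// ?invr_ge0 ?exprn_ge0// ltW.
Qed.

Lemma oppr1_sqr : (-1 : R) ^+ 2 = 1.
Proof. by rewrite sqrrN expr1n. Qed.

Lemma sqr_factor b z : b%:C ^+ 2 - z ^+ 2 =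
  (b%:C + 1%:C * z) * (b%:C + (-1)%:C * z).
Proof. by rewrite rmorphN/= rmorph1; ring. Qed.

Lemma decays_invsqr b : r < b -> decays 2 (fun z => (b%:C ^+ 2 - z ^+ 2)^-1).
Proof.
move=> rb.
have h := decaysM (decays_invlinear (expr1n _ 2) rb) (decays_invlinear oppr1_sqr rb).
by apply: eq_decays h => z _; rewrite sqr_factor invfM.
Qed.

Lemma sqr_neq0 b z : r < b -> `|Re z| < r -> b%:C ^+ 2 - z ^+ 2 != 0.
Proof.
move=> rb zr; rewrite sqr_factor mulf_neq0//.
  exact: linear_neq0 (expr1n _ 2) rb zr.
exact: linear_neq0 oppr1_sqr rb zr.
Qed.

Lemma decays_id_invsqr b : r < b ->
  decays 1 (fun z => z / (b%:C ^+ 2 - z ^+ 2)).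
Proof.
move=> rb.
have h := decaysD (decays_invlinear oppr1_sqr rb)
  (decaysZ (-1) (decays_invlinear (expr1n _ 2) rb)).
apply: eq_decays (decaysZ 2^-1 h) => z zr; rewrite sqr_factor.
have n1 := linear_neq0 (expr1n _ 2) rb zr.
have n2 := linear_neq0 oppr1_sqr rb zr.
move: n1 n2; rewrite rmorphN/= rmorph1 mul1r mulN1r => n1 n2.
have n3 : (2 : R[i]) != 0 by rewrite pnatr_eq0.
by field; rewrite n1 n2.
Qed.

Lemma decays_ratio a b : r < b ->
  decays 0 (fun z => (a%:C ^+ 2 - z ^+ 2) / (b%:C ^+ 2 - z ^+ 2)).
Proof.
move=> rb.
have h := decaysD (decays_cst 1)
  (decays_bounded (decaysZ (a%:C ^+ 2 - b%:C ^+ 2) (decays_invsqr rb))).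
by apply: eq_decays h => z zr; have n := sqr_neq0 rb zr; field.
Qed.

Lemma decays_prod n (F : nat -> R[i] -> R[i]) : (forall j, decays 0 (F j)) ->
  decays 0 (fun z => \prod_(j < n) F j z).
Proof.
move=> h; elim: n => [|n IH].
  by apply: eq_decays (decays_cst 1) => z _; rewrite big_ord0.
by apply: eq_decays (decaysM IH (h n)) => z _; rewrite big_ord_recr.
Qed.

(** Up to normalisation, the truncated product for the reciprocal of
    [Gamma(a + z) Gamma(a - z)]. *)
Definition sqprod n a z : R[i] := \prod_(j < n) ((a + j%:R)%:C ^+ 2 - z ^+ 2).

Lemma decays_sqprod_ratio n a b : r < b ->
  decays 0 (fun z => sqprod n a z / sqprod n b z).
Proof.
move=> rb.
apply: (@eq_decays _ (fun z => \prod_(j < n)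
   (((a + j%:R)%:C ^+ 2 - z ^+ 2) / ((b + j%:R)%:C ^+ 2 - z ^+ 2)))).
  by move=> z _; rewrite big_split/= -prodfV.
apply: (@decays_prod _ (fun j z =>
  ((a + j%:R)%:C ^+ 2 - z ^+ 2) / ((b + j%:R)%:C ^+ 2 - z ^+ 2))) => j.
by apply: decays_ratio; rewrite (lt_le_trans rb)// lerDl.
Qed.

Lemma decays_invsqprod n b : r < b -> decays 0 (fun z => (sqprod n b z)^-1).
Proof.
move=> rb.
apply: (@eq_decays _ (fun z => \prod_(j < n) ((b + j%:R)%:C ^+ 2 - z ^+ 2)^-1)).
  by move=> z _; rewrite prodfV.
apply: (@decays_prod _ (fun j z => ((b + j%:R)%:C ^+ 2 - z ^+ 2)^-1)) => j.
by apply: decays_bounded; apply: decays_invsqr; rewrite (lt_le_trans rb)// lerDl.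
Qed.

End StripRational.

(** * The contour shift for the truncated weight *)

Section StripIntegral.
Variable R : realType.
Notation mu := (@lebesgue_measure R).
Implicit Types (f : R[i] -> R[i]) (z : R[i]) (a b : R).

Lemma sqr_sqrt_oneDsqr (s : R) : Num.sqrt (oneDsqr s) ^+ 2 = oneDsqr s.
Proof. by rewrite sqr_sqrtr// (le_trans ler01)// oneDsqr_ge1. Qed.

Lemma decays_continuous (r : R) k f (x : R) : decays r k f -> `|x| < r ->
  continuous (fun s : R => Re (f (x +i* s))).
Proof. by move=> [df hf] xr; have [] := strip_hol_continuous hf xr. Qed.

(** Both symmetry hypotheses hold for odd functions with real coefficients. *)
Lemma integral_strip_eq0 (r : R) f : 2^-1 < r -> decays r 2 f ->
    (forall x : R, Im (f x%:C) = 0) ->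
    (forall s : R, Re (f (0 +i* s)) = 0) ->
  \int[mu]_(s in `[0, +oo[) Re (f (2^-1 +i* s)) = 0.
Proof.
move=> r2 [df hf] freal fimag.
have [df_xs cdf [C fC]] := hf.
have cf := strip_hol_continuous hf.
have bd (x s : R) : `|x| < r ->
    [/\ `|Re (f (x +i* s))| <= C / oneDsqr s, `|Im (f (x +i* s))| <= C / oneDsqr s
      & `|Re (df (x +i* s))| <= C / oneDsqr s].
  move=> xr; have [] := fC x s xr; rewrite sqr_sqrt_oneDsqr => b1 b2.
  split; [exact: le_trans (Re_le_normc _) b1|exact: le_trans (Im_le_normc _) b1|].
  exact: le_trans (Re_le_normc _) b2.
apply: (@half_strip_shift _ (fun x s => Re (f (x +i* s)))
  (fun x s => Im (f (x +i* s))) (fun x s => Re (df (x +i* s))) r C) => //.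
- by move=> x s xr; have [[]] := df_xs x s xr.
- move=> x s xr; have [_ [_]] := df_xs x s xr.
  by rewrite Im_mul /= mul0r add0r mul1r.
- by move=> x xr; have [] := cf x xr.
- by move=> x xr; have [] := cdf x xr.
- by move=> x s xr; have [] := bd x s xr.
- by move=> x s xr; have [] := bd x s xr.
- by move=> x s xr; have [] := bd x s xr.
Qed.

Lemma sqprodD n m a z :
  sqprod (n + m) a z = sqprod n a z * sqprod m (a + n%:R) z.
Proof.
rewrite /sqprod big_split_ord/=; congr (_ * _).
by apply: eq_bigr => j _; rewrite natrD addrA.
Qed.

Lemma sqprodS n a z :
  sqprod n.+1 a z = (a%:C ^+ 2 - z ^+ 2) * sqprod n (a + 1) z.
Proof. by rewrite -add1n sqprodD /sqprod big_ord1 addr0. Qed.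

Lemma sqprodSr n a z :
  sqprod n.+1 a z = sqprod n a z * ((a + n%:R)%:C ^+ 2 - z ^+ 2).
Proof. by rewrite /sqprod big_ord_recr. Qed.

(** The two reflected factors move in opposite directions under a shift by
    one half, so that all but one of the factors are shared. *)
Lemma sqprod_half_shift n a z :
  sqprod n (a + 2^-1) (2^-1%:C + z) * (a%:C + z) =
  sqprod n a z * ((a + n%:R)%:C + z).
Proof.
elim: n => [|n IH]; first by rewrite /sqprod !big_ord0 addr0.
rewrite !sqprodSr mulrAC IH.
rewrite -!mulrA; congr (_ * _).
have h2 : (2^-1%:C : R[i]) * 2 = 1.
  have -> : (2 : R[i]) = 2%:C by rewrite (rmorph_nat (real_complex R) 2).
  by rewrite -rmorphM/= mulVf ?rmorph1// pnatr_eq0.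
rewrite -natr1 !rmorphD/= rmorph1 !rmorph_nat.
have -> : (1 : R[i]) = 2^-1%:C * 2 by rewrite h2.
ring.
Qed.

(** Truncation of the odd function whose difference between the abscissas
    [1/2] and [-1/2] is a constant times the weight times the degree-one Wilson polynomial; its
    parameters are [p + 1/2], [u + 1/2], [v + 1/2], [q - 1/2]. The
    factors [sqprod n 1] and [sqprod n 2^-1], with [z], come from
    [1/(2z Gamma(2z) Gamma(-2z))] by duplication. *)
Definition half_weight (n m : nat) (p u v q : R) z : R[i] :=
  z * sqprod n 1 z * sqprod n 2^-1 z * sqprod m.+1 (q - 2^-1) z /
  (sqprod n (p + 2^-1) z * sqprod n (u + 2^-1) z * sqprod n (v + 2^-1) z).

(** Each factor of the numerator is paired with one of the denominator; the
    [k.+2 = n - m.+1] factors of [v] left over provide the decay. *)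
Lemma decays_half_weight m k (p u v q r : R) :
    r < p + 2^-1 -> r < u + 2^-1 -> r < v + 2^-1 ->
  decays r 2 (half_weight (m.+1 + k.+2) m p u v q).
Proof.
move=> rp ru rv; set n := (m.+1 + k.+2)%N.
pose b := v + 2^-1 + m.+1%:R.
have rb : r < b by rewrite (lt_le_trans rv)// lerDl.
have rb1 : r < b + 1 by rewrite (lt_le_trans rb)// lerDl.
have rb2 : r < b + 1 + 1 by rewrite (lt_le_trans rb1)// lerDl.
have h1 := decaysM (decays_sqprod_ratio n 1 rp) (decays_sqprod_ratio n 2^-1 ru).
have h2 := decaysM h1 (decays_sqprod_ratio m.+1 (q - 2^-1) rv).
have h3 := decaysM h2 (decays_id_invsqr rb).
have h4 := decaysM h3 (decays_invsqr rb1).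
have h5 := decaysM h4 (decays_invsqprod k rb2).
apply: eq_decays (decays_weaken h5) => z _; rewrite /half_weight.
by rewrite [sqprod n (v + _) z]sqprodD !sqprodS -/b !invfM; ring.
Qed.

Lemma sqprod_real n a (x : R) : sqprod n a x%:C \is Num.real.
Proof.
apply: rpred_prod => j _; rewrite -!rmorphXn -rmorphB/=.
by apply/complex_realP; eexists.
Qed.

Lemma sqprod_imag n a (s : R) :
  sqprod n a (0 +i* s) = (\prod_(j < n) ((a + j%:R) ^+ 2 + s ^+ 2))%:C.
Proof.
rewrite /sqprod rmorph_prod; apply: eq_bigr => j _.
rewrite [in RHS]rmorphD/= !rmorphXn/=; congr (_ + _).
by rewrite !expr2; simpc.
Qed.

Section HalfWeight.
Variables (m k : nat) (p u v q : R).
Hypotheses (p0 : 0 < p) (u0 : 0 < u) (v0 : 0 < v).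
Let om := half_weight (m.+1 + k.+2) m p u v q.

Lemma half_weight_strip : exists2 r, 2^-1 < r & decays r 2 om.
Proof.
pose t := Num.min p (Num.min u v).
have t0 : 0 < t by rewrite !lt_min p0 u0.
have tp : t <= p by rewrite ge_min lexx.
have tu : t <= u by rewrite !ge_min lexx orbT.
have tv : t <= v by rewrite !ge_min lexx !orbT.
exists (2^-1 + t / 2); first by rewrite ltrDl divr_gt0.
by apply: decays_half_weight; lra.
Qed.

Lemma continuous_half_weight : continuous (fun s : R => Re (om (2^-1 +i* s))).
Proof.
have [r r2 dr] := half_weight_strip.
by apply: (decays_continuous dr); rewrite ger0_norm ?invr_ge0.
Qed.

Lemma integrable_half_weight :
  mu.-integrable `[0, +oo[ (EFin \o (fun s : R => Re (om (2^-1 +i* s)))).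
Proof.
have [r r2 [df [_ _ [C HC]]]] := half_weight_strip.
apply: (@integrable_quadratic_decay _ _ C) => [|s _].
  by apply: measurable_funTS; apply: continuous_measurable_fun; exact: continuous_half_weight.
have r2' : `|2^-1 : R| < r by rewrite ger0_norm ?invr_ge0.
have [h _] := HC 2^-1 s r2'; rewrite sqr_sqrt_oneDsqr in h.
exact: le_trans (Re_le_normc _) h.
Qed.

Lemma integral_half_weight_eq0 :
  \int[mu]_(s in `[0, +oo[) Re (om (2^-1 +i* s)) = 0.
Proof.
have [r r2 dr] := half_weight_strip.
apply: (integral_strip_eq0 r2 dr).
- move=> x; apply/complexI/RIm_real.
  rewrite /om /half_weight !(rpredM, rpredV) ?sqprod_real//.
  by apply/complex_realP; exists x.
- move=> s; rewrite /om /half_weight !sqprod_imag.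
  by rewrite -!rmorphM -fmorphV -!mulrA -!rmorphM/= mul0r; simpc.
Qed.

End HalfWeight.

End StripIntegral.

(** * The infinite products for the squared modulus of Gamma *)

Section GammaProducts.
Variable R : realType.
Implicit Types (a b s : R) (n : nat).

(** The telescoping bound [1/(n + 1)^2 <= 2/(n + 1) - 2/(n + 2)] is carried
    through the induction. *)
Lemma le_expR_of_growth (x : nat -> R) (C : R) : 0 <= C ->
    (forall n, 0 <= x n) ->
    (forall n, x n.+1 <= x n * (1 + C / n.+1%:R ^+ 2)) ->
  forall n, x n <= x 0%N * expR (2 * C).
Proof.
move=> C0 x0 xS n.
suff H : x n <= x 0%N * expR (2 * C - 2 * C / n.+1%:R).
  apply: (le_trans H); rewrite ler_wpM2l// ler_expR lerBlDr lerDl.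
  by rewrite divr_ge0// mulr_ge0.
elim: n => [|n IH]; first by rewrite divr1 subrr expR0 mulr1.
apply: (le_trans (xS n)).
apply: (@le_trans _ _ (x 0%N * expR (2 * C - 2 * C / n.+1%:R) * expR (C / n.+1%:R ^+ 2))).
  apply: ler_pM => //; first by rewrite addr_ge0// divr_ge0// sqr_ge0.
  exact: expR_ge1Dx.
rewrite -mulrA -expRD ler_wpM2l// ler_expR.
have n1 : 1 <= n.+1%:R :> R by rewrite ler1n.
rewrite -[in leRHS](@natr1 _ n.+1); set t : R := n.+1%:R in n1 *.
have t0 : 0 < t by rewrite (lt_le_trans ltr01).
have t10 : 0 < t + 1 by rewrite addr_gt0.
rewrite -subr_ge0.
have -> : 2 * C - 2 * C / (t + 1) - (2 * C - 2 * C / t + C / t ^+ 2) =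
  C * (t - 1) / (t ^+ 2 * (t + 1)).
  by field; rewrite !gt_eqF.
by rewrite divr_ge0 ?mulr_ge0 ?subr_ge0 ?sqr_ge0// ltW.
Qed.

(** Partial products of [|Gamma a / Gamma (a + is)|^2]. *)
Definition gprod n a s : R := \prod_(j < n) (1 + s ^+ 2 / (a + j%:R) ^+ 2).

Lemma gprodSr n a s : gprod n.+1 a s = gprod n a s * (1 + s ^+ 2 / (a + n%:R) ^+ 2).
Proof. by rewrite /gprod big_ord_recr. Qed.

Lemma gprodD n m a s : gprod (n + m) a s = gprod n a s * gprod m (a + n%:R) s.
Proof.
rewrite /gprod big_split_ord/=; congr (_ * _).
by apply: eq_bigr => j _; rewrite natrD addrA.
Qed.

Lemma gprodS n a s : gprod n.+1 a s = (1 + s ^+ 2 / a ^+ 2) * gprod n (a + 1) s.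
Proof. by rewrite -add1n gprodD /gprod big_ord1 addr0. Qed.

Lemma gfactor_ge1 a s : 1 <= 1 + s ^+ 2 / a ^+ 2.
Proof. by rewrite lerDl divr_ge0// sqr_ge0. Qed.

Lemma gprod_ge1 n a s : 1 <= gprod n a s.
Proof.
elim: n => [|n IH]; first by rewrite /gprod big_ord0.
by rewrite gprodSr mulr_ege1// gfactor_ge1.
Qed.

Lemma gprod_gt0 n a s : 0 < gprod n a s.
Proof. exact: lt_le_trans ltr01 (gprod_ge1 _ _ _). Qed.

Lemma gprod_nondecreasing a s : nondecreasing_seq (fun n => gprod n a s).
Proof.
apply/nondecreasing_seqP => n.
by rewrite gprodSr ler_peMr ?gfactor_ge1// ltW// gprod_gt0.
Qed.

Lemma le_gprod n a b s : 0 < a -> a <= b -> gprod n b s <= gprod n a s.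
Proof.
move=> a0 ab; apply: ler_prod => j _.
rewrite (le_trans ler01 (gfactor_ge1 _ _))/= lerD2l ler_wpM2l ?sqr_ge0//.
have aj : 0 < a + j%:R by rewrite ltr_wpDr.
have abj : a + j%:R <= b + j%:R by rewrite lerD2r.
have bj : 0 < b + j%:R by rewrite (lt_le_trans aj).
rewrite lef_pV2 ?posrE ?exprn_gt0//.
by rewrite ler_pXn2r// nnegrE ltW.
Qed.

Lemma gfactor_le a s j : 0 < a ->
  s ^+ 2 / (a + j%:R) ^+ 2 <= s ^+ 2 * (1 + a^-1) ^+ 2 / j.+1%:R ^+ 2.
Proof.
move=> a0; rewrite -mulrA ler_wpM2l ?sqr_ge0//.
have aj : 0 < a + j%:R by rewrite ltr_wpDr.
rewrite -expr_div_n -exprVn ler_pXn2r ?nnegrE ?invr_ge0 ?(ltW aj)//; last first.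
  by rewrite mulr_ge0// ?invr_ge0// addr_ge0// invr_ge0 ltW.
rewrite -[leLHS]mul1r ler_pdivrMr// mulrAC ler_pdivlMr// mul1r -natr1.
have j0 : 0 <= j%:R :> R by [].
have : (a + j%:R) * (1 + a^-1) - (j%:R + 1) = a + j%:R / a.
  by field; rewrite gt_eqF.
have : 0 <= a + j%:R / a by rewrite addr_ge0 ?divr_ge0// ltW.
by move=> h e; rewrite mulrC -subr_ge0 e.
Qed.

Lemma gprod_le_expR n a s : 0 < a ->
  gprod n a s <= expR (2 * (s ^+ 2 * (1 + a^-1) ^+ 2)).
Proof.
move=> a0.
have := @le_expR_of_growth (fun n => gprod n a s) (s ^+ 2 * (1 + a^-1) ^+ 2).
have -> : gprod 0 a s = 1 by rewrite /gprod big_ord0.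
rewrite mul1r; apply.
- by rewrite mulr_ge0 ?sqr_ge0.
- by move=> k; rewrite ltW// gprod_gt0.
- by move=> k; rewrite gprodSr ler_wpM2l ?(ltW (gprod_gt0 _ _ _))// lerD2l gfactor_le.
Qed.

Definition glim a s : R := limn (fun n => gprod n a s).

Lemma cvg_gprod a s : 0 < a -> (fun n => gprod n a s) @ \oo --> glim a s.
Proof.
move=> a0; apply: nondecreasing_is_cvgn; first exact: gprod_nondecreasing.
by exists (expR (2 * (s ^+ 2 * (1 + a^-1) ^+ 2))) => _ [n _ <-]; exact: gprod_le_expR.
Qed.

Lemma glim_ge1 a s : 0 < a -> 1 <= glim a s.
Proof.
move=> a0; apply: limr_ge; first by apply: cvgP; exact: cvg_gprod.
by apply: nearW => n; exact: gprod_ge1.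
Qed.

Lemma glim_gt0 a s : 0 < a -> 0 < glim a s.
Proof. by move=> a0; exact: lt_le_trans ltr01 (glim_ge1 s a0). Qed.

Lemma glim_shift a s : 0 < a ->
  glim a s = (1 + s ^+ 2 / a ^+ 2) * glim (a + 1) s.
Proof.
move=> a0; have a1 : 0 < a + 1 by rewrite addr_gt0.
apply/cvg_lim => //; rewrite -cvg_shiftS/=.
under eq_cvg do rewrite gprodS.
by apply: cvgMl_tmp; exact: cvg_gprod.
Qed.

Lemma continuous_gprod n a : continuous (gprod n a).
Proof.
elim: n => [|n IH] s.
  rewrite (_ : gprod 0 a = cst 1); first exact: cst_continuous.
  by apply/funext => t; rewrite /gprod big_ord0.
rewrite (_ : gprod n.+1 a = fun s => gprod n a s * (1 + s ^+ 2 / (a + n%:R) ^+ 2)).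
  apply: cvgM; first exact: IH.
  apply: cvgD; first exact: cvg_cst.
  by apply: cvgMr_tmp; exact: exprn_continuous.
by apply/funext => t; rewrite gprodSr.
Qed.

Lemma gprod_upper i a : 0 < a ->
  exists2 C : R, 0 < C & forall s, gprod i a s <= C * oneDsqr s ^+ i.
Proof.
move=> a0; elim: i => [|i [C C0 HC]].
  by exists 1 => // s; rewrite /gprod big_ord0 mul1r.
have ai : 0 < a + i%:R by rewrite ltr_wpDr.
exists (C * (1 + (a + i%:R) ^- 2)) => [|s].
  by rewrite mulr_gt0// addr_gt0// invr_gt0 exprn_gt0.
rewrite gprodSr (exprSr (oneDsqr s)) [leRHS]mulrACA; apply: ler_pM => //.
- exact/ltW/gprod_gt0.
- exact: le_trans ler01 (gfactor_ge1 _ _).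
- rewrite /oneDsqr; set y := _ ^- 2.
  have y0 : 0 <= y by rewrite invr_ge0 sqr_ge0.
  by have := sqr_ge0 s; nra.
Qed.

Lemma gprod_lower i a : 0 < a ->
  exists2 c : R, 0 < c & forall s, c * oneDsqr s ^+ i <= gprod i a s.
Proof.
move=> a0; elim: i => [|i [c c0 Hc]].
  by exists 1 => // s; rewrite /gprod big_ord0 mul1r.
have ai : 0 < a + i%:R by rewrite ltr_wpDr.
pose y := Num.min 1 ((a + i%:R) ^- 2).
have y0 : 0 < y by rewrite lt_min ltr01 invr_gt0 exprn_gt0.
exists (c * y) => [|s]; first by rewrite mulr_gt0.
rewrite gprodSr (exprSr (oneDsqr s)) [leLHS]mulrACA; apply: ler_pM => //.
- by rewrite mulr_ge0 ?exprn_ge0 ?(le_trans ler01 (oneDsqr_ge1 _))// ltW.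
- by rewrite mulr_ge0 ?(le_trans ler01 (oneDsqr_ge1 _))// ltW.
- have y1 : y <= 1 by rewrite ge_min lexx.
  have y2 : y <= (a + i%:R) ^- 2 by rewrite ge_min lexx orbT.
  rewrite /oneDsqr; move: y2; set w := _ ^- 2 => y2.
  by have := sqr_ge0 s; nra.
Qed.

(** The first [i] factors absorb the passage from [a] to [a + i], after which
    factors can be compared one by one. *)
Lemma gprod_le_mul n i a b s : 0 < a -> 0 < b -> b <= a + i%:R ->
  gprod n a s <= gprod i a s * gprod n b s.
Proof.
move=> a0 b0 ba; apply: (@le_trans _ _ (gprod (i + n) a s)).
  by apply: (gprod_nondecreasing a s); rewrite leq_addl.
rewrite gprodD ler_wpM2l ?(ltW (gprod_gt0 _ _ _))//.
exact: le_gprod.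
Qed.

End GammaProducts.

(** * Convergence of Euler's limit *)

Section GammaConvergence.
Variable R : realType.
Implicit Types (a s x y t : R) (z w : R[i]).

Lemma abs_sin_le y : `|sin y| <= `|y|.
Proof.
wlog y0 : y / 0 <= y.
  move=> H; have [/H//|/ltW y0] := leP 0 y.
  by rewrite -normrN -sinN -[leRHS]normrN H// oppr_ge0.
have [|c _] := @MVT_segment R sin cos 0 y y0.
  by apply: continuous_subspaceT; exact: continuous_sin.
rewrite sin0 !subr0 => ->; rewrite normrM ler_piMl//.
by rewrite ler_norml cos_geN1 cos_le1.
Qed.

Lemma abs_cosB1_le y : `|cos y - 1| <= y ^+ 2.
Proof.
wlog y0 : y / 0 <= y.
  move=> H; have [/H//|/ltW y0] := leP 0 y.
  by rewrite -cosN -sqrrN H// oppr_ge0.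
have [|c] := @MVT_segment R cos (fun x => - sin x) 0 y y0.
  by apply: continuous_subspaceT; exact: continuous_cos.
rewrite in_itv/= => /andP[c0 cy].
rewrite cos0 !subr0 => ->; rewrite normrM normrN expr2 (ger0_norm y0) ler_wpM2r//.
by rewrite (le_trans (abs_sin_le c))// ger0_norm.
Qed.

Lemma abs_sinB_le y : `|sin y - y| <= `|y| * y ^+ 2.
Proof.
wlog y0 : y / 0 <= y.
  move=> H; have [/H//|/ltW y0] := leP 0 y.
  by have := H (- y); rewrite oppr_ge0 => /(_ y0); rewrite sinN -opprD normrN sqrrN normrN.
have [|c] := @MVT_segment R (fun x => sin x - x) (fun x => cos x - 1) 0 y y0.
  by apply: continuous_subspaceT => x; apply: cvgB; [exact: continuous_sin|exact: cvg_id].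
rewrite in_itv/= => /andP[c0 cy].
rewrite sin0 !subr0 => ->; rewrite normrM mulrC ler_wpM2l//.
by rewrite (le_trans (abs_cosB1_le c))// ler_pXn2r.
Qed.

Lemma expRB1_le x : expR x - 1 <= x * expR x.
Proof.
have := expR_ge1Dx (- x); rewrite expRN => h.
have := ler_wpM2r (expR_ge0 x) h; rewrite mulVf ?gt_eqF ?expR_gt0// mulrDl mul1r mulNr.
lra.
Qed.

Lemma expRB1B_le x : 0 <= x -> expR x - 1 - x <= x ^+ 2 * expR x.
Proof.
move=> x0; have h := expRB1_le x.
have := ler_wpM2l x0 h; rewrite mulrA -expr2 mulrBr mulr1.
lra.
Qed.

Lemma cexpD z w : cexp (z + w) = cexp z * cexp w.
Proof.
case: z w => [a b] [c d]; rewrite /cexp/= expRD cosD sinD.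
by simpc; congr (_ +i* _); ring.
Qed.

Lemma normc_cexp z : normc (cexp z) = expR (Re z).
Proof.
rewrite /cexp ComplexField.Normc.normcM normc_real ger0_norm ?expR_ge0//.
by rewrite [X in _ * X]normcE2/= cos2Dsin2 sqrtr1 mulr1.
Qed.

(** The components of [e^(x + iy) - 1 - (x + iy)] are
    [(e^x - 1 - x) cos y + (1 + x)(cos y - 1)] and
    [(e^x - 1) sin y + (sin y - y)]. *)
Lemma cexp_taylor a s : 0 <= a -> exists2 K : R, 0 <= K & forall t, 0 <= t <= 1 ->
  normc (cexp ((a +i* s) * t%:C) - 1 - (a +i* s) * t%:C) <= K * t ^+ 2.
Proof.
move=> a0; pose E := expR a; have E0 : 0 <= E by exact: expR_ge0.
exists (a ^+ 2 * E + (1 + a) * s ^+ 2 + (a * E * `|s| + `|s| * s ^+ 2)).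
  by do ?[exact: sqr_ge0|apply: addr_ge0|apply: mulr_ge0].
move=> t /andP[t0 t1].
pose x := a * t; pose y := s * t.
have -> : (a +i* s) * t%:C = x +i* y by rewrite /x /y; simpc.
have x0 : 0 <= x by rewrite mulr_ge0.
have xa : x <= a by rewrite ler_piMr.
have ex : expR x <= E by rewrite ler_expR.
have e0 := expR_ge0 x.
have y2 : y ^+ 2 = s ^+ 2 * t ^+ 2 by rewrite exprMn.
have x2 : x ^+ 2 = a ^+ 2 * t ^+ 2 by rewrite exprMn.
have e1 : 0 <= expR x - 1 - x by have := expR_ge1Dx x; lra.
rewrite [leRHS]mulrDl; apply: (le_trans (normc_le_ReIm _)); apply: lerD.
  rewrite /cexp/=.
  have -> : expR x * cos y - 0 * sin y - 1 - x =
    (expR x - 1 - x) * cos y + (1 + x) * (cos y - 1) by ring.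
  rewrite [leRHS]mulrDl; apply: (le_trans (ler_normD _ _)); rewrite !normrM; apply: lerD.
    apply: (@le_trans _ _ (expR x - 1 - x)).
      by rewrite (ger0_norm e1) ler_piMr// ler_norml cos_geN1 cos_le1.
    apply: (le_trans (expRB1B_le x0)); rewrite x2 [leRHS]mulrAC.
    by rewrite ler_wpM2l// mulr_ge0 ?sqr_ge0.
  rewrite -mulrA -y2; apply: ler_pM => //; last exact: abs_cosB1_le.
  by rewrite ger0_norm ?addr_ge0// lerD2l.
rewrite /cexp/=.
have -> : expR x * sin y + 0 * cos y - 0 - y =
  (expR x - 1) * sin y + (sin y - y) by ring.
rewrite [leRHS]mulrDl; apply: (le_trans (ler_normD _ _)); apply: lerD.
  rewrite normrM.
  have -> : a * E * `|s| * t ^+ 2 = (x * E) * `|y|.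
    by rewrite /x /y normrM (ger0_norm t0); ring.
  apply: ler_pM => //; last exact: abs_sin_le.
  rewrite ger0_norm ?subr_ge0 ?expR_ge1//; last by lra.
  by rewrite (le_trans (expRB1_le x))// ler_wpM2l.
apply: (le_trans (abs_sinB_le y)); rewrite -mulrA -y2 ler_wpM2r ?sqr_ge0//.
by rewrite /y normrM (ger0_norm t0) ler_piMr.
Qed.

(** Subtracting [2D/(n + 1)], whose decrements are at least [D/(n + 1)^2], makes the
    sequence nondecreasing. *)
Lemma cvgn_of_sqr_increments (y : nat -> R) (B D : R) :
    (forall n, `|y n| <= B) -> (forall n, `|y n.+1 - y n| <= D / n.+1%:R ^+ 2) ->
  cvgn y.
Proof.
move=> yB yD.
have D0 : 0 <= D by have := le_trans (normr_ge0 _) (yD 0%N); rewrite expr1n divr1.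
pose t n := y n - 2 * D / n.+1%:R.
have ct : cvgn t.
  apply: nondecreasing_is_cvgn.
    apply/nondecreasing_seqP => n; rewrite /t -subr_ge0.
    have := yD n; rewrite ler_norml => /andP[h _].
    rewrite -(@natr1 _ n.+1); have n1 : 1 <= n.+1%:R :> R by rewrite ler1n.
    set m : R := n.+1%:R in n1 h *.
    have m0 : 0 < m by rewrite (lt_le_trans ltr01).
    have m10 : 0 < m + 1 by rewrite addr_gt0.
    have E : y n.+1 - 2 * D / (m + 1) - (y n - 2 * D / m) =
      (y n.+1 - y n + D / m ^+ 2) + D * (m - 1) / (m ^+ 2 * (m + 1)).
      by field; rewrite !gt_eqF.
    rewrite E addr_ge0//; first by rewrite -lerBlDr sub0r.
    by rewrite divr_ge0 ?mulr_ge0 ?subr_ge0 ?sqr_ge0// ltW.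
  exists B => _ [n _ <-]; rewrite /t lerBlDr (le_trans (ler_norm _))//.
  by rewrite (le_trans (yB n))// lerDl divr_ge0// mulr_ge0.
rewrite (_ : y = t + (fun n => (2 * D) * harmonic n)); last first.
  by apply/funext => n; rewrite /t /= subrK.
apply: is_cvgD => //; apply: (cvgP (2 * D * 0)).
by apply: cvgMl_tmp; exact: cvg_harmonic.
Qed.

Lemma cvg_complex (x : nat -> R[i]) (a b : R) :
    (fun n => Re (x n)) @ \oo --> a -> (fun n => Im (x n)) @ \oo --> b ->
  (fun n => x n : R[i]^o) @ \oo --> (a +i* b : R[i]^o).
Proof.
move=> ca cb; apply/cvgrPdist_lt => e.
rewrite ltcE /= => /andP[/eqP Ie Re0].
have e20 : 0 < Re e / 2 by rewrite divr_gt0.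
near=> n.
rewrite (_ : `|_| = (normc ((a +i* b) - x n))%:C) ; last by rewrite normc_def normcE2.
rewrite ltcE /= Ie eqxx/=.
apply: (le_lt_trans (normc_le_ReIm _)); rewrite Re_add Im_add Re_opp Im_opp/=.
rewrite [ltRHS]splitr; apply: ltrD.
  by near: n; move/cvgrPdist_lt: ca => /(_ _ e20).
by near: n; move/cvgrPdist_lt: cb => /(_ _ e20).
Unshelve. all: by end_near. Qed.

Lemma cvg_complex_product (x : nat -> R[i]) (K : R) :
    (forall n, normc (x n.+1 - x n) <= K / n.+1%:R ^+ 2 * normc (x n)) ->
  cvgn (fun n => Re (x n)) /\ cvgn (fun n => Im (x n)).
Proof.
move=> xK; pose K' := `|K|.
have K'0 : 0 <= K' by exact: normr_ge0.
have xK' n : normc (x n.+1 - x n) <= K' / n.+1%:R ^+ 2 * normc (x n).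
  apply: (le_trans (xK n)); rewrite ler_wpM2r ?normc_ge0//.
  by rewrite ler_wpM2r ?ler_norm// invr_ge0 sqr_ge0.
pose B := normc (x 0%N) * expR (2 * K').
have xB n : normc (x n) <= B.
  apply: (@le_expR_of_growth _ (fun n => normc (x n))) => // [k|k]; first exact: normc_ge0.
  rewrite mulrDr mulr1 mulrC -{1}[x k.+1](subrK (x k)) addrC.
  by rewrite (le_trans (le_normcD _ _))// lerD2l mulrC (le_trans (xK' k))// mulrC.
have inc n : normc (x n.+1 - x n) <= K' * B / n.+1%:R ^+ 2.
  apply: (le_trans (xK' n)); rewrite mulrAC ler_wpM2r ?invr_ge0 ?sqr_ge0//.
  by rewrite ler_wpM2l.
split; apply: (@cvgn_of_sqr_increments _ B (K' * B)) => n.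
- exact: le_trans (Re_le_normc _) (xB n).
- by rewrite -Re_opp -Re_add; exact: le_trans (Re_le_normc _) (inc n).
- exact: le_trans (Im_le_normc _) (xB n).
- by rewrite -Im_opp -Im_add; exact: le_trans (Im_le_normc _) (inc n).
Qed.

End GammaConvergence.

Section GammaModulus.
Variable R : realType.
Implicit Types (a s x y t : R) (z w : R[i]).

(** The sequence whose limit defines [Gamma z]. *)
Definition euler_seq n z : R[i] :=
  (n`!)%:R * cexp (z * (ln n%:R)%:C) / poch z n.+1.

Lemma pochS (F : pzRingType) (x : F) k : poch x k.+1 = poch x k * (x + k%:R).
Proof. by rewrite /poch big_ord_recr. Qed.

Lemma natr_complex n : (n%:R : R[i]) = (n%:R : R)%:C.
Proof. by rewrite rmorph_nat. Qed.

Lemma ln_ratio_bounds n : let l := ln n.+2%:R - ln n.+1%:R : R in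
  [/\ n.+2%:R^-1 <= l & l <= n.+1%:R^-1].
Proof.
have n1 : 0 < n.+1%:R :> R by [].
have n2 : 0 < n.+2%:R :> R by [].
have nE : n.+2%:R = n.+1%:R + 1 :> R by rewrite natr1.
split; rewrite -ln_div ?posrE//.
  rewrite -[leLHS]opprK lerNl -lnV ?posrE ?divr_gt0// invf_div.
  have -> : n.+1%:R / n.+2%:R = 1 + - n.+2%:R^-1 :> R.
    rewrite nE; move: n1; set m : R := n.+1%:R => m0.
    by field; rewrite gt_eqF// addr_gt0.
  by apply: le_ln1Dx; rewrite ltrN2 invf_lt1// ltr1n.
have -> : n.+2%:R / n.+1%:R = 1 + n.+1%:R^-1 :> R.
  by rewrite nE mulrDl divff ?gt_eqF// mul1r.
by apply: le_ln1Dx; rewrite (lt_trans (ltrN10 _))// invr_gt0.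
Qed.

(** Consecutive terms have ratio [(n + 1) e^(zl) / (z + n + 1)] with
    [l = ln (1 + 1/n)], and both [e^(zl)] and [(z + n + 1)/(n + 1)] are
    [1 + z/n] up to an error of order [1/n^2]. *)
Lemma euler_seq_increment a s : 0 <= a -> exists K : R, forall n,
  normc (euler_seq n.+2 (a +i* s) - euler_seq n.+1 (a +i* s)) <=
  K / n.+1%:R ^+ 2 * normc (euler_seq n.+1 (a +i* s)).
Proof.
move=> a0; have [K K0 hK] := cexp_taylor s a0.
set z := a +i* s in hK *.
exists (K + normc z) => n.
have [l1 l2] := ln_ratio_bounds n.
set l := _ - _ in l1 l2.
have n1 : 0 < n.+1%:R :> R by [].
have n2 : 0 < n.+2%:R :> R by [].
have nE : n.+2%:R = n.+1%:R + 1 :> R by rewrite natr1.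
have l0 : 0 <= l by rewrite (le_trans _ l1)// invr_ge0.
have l3 : l <= 1 by rewrite (le_trans l2)// invf_le1// ler1n.
pose D := z + n.+2%:R.
have ReD : Re D = a + n.+2%:R by rewrite /D natr_complex Re_add.
have D0 : D != 0.
  by apply/eqP => D0; move: ReD; rewrite D0 => /= /esym/eqP; rewrite gt_eqF// ltr_wpDl.
have nD : n.+2%:R <= normc D.
  by rewrite (le_trans _ (Re_le_normc _))// ReD ger0_norm ?lerDr// addr_ge0.
have E : euler_seq n.+2 z = euler_seq n.+1 z * (n.+2%:R * cexp (z * l%:C) / D).
  rewrite /euler_seq pochS -/D factS natrM.
  have -> : z * (ln n.+2%:R)%:C = z * (ln n.+1%:R)%:C + z * l%:C.
    by rewrite -mulrDr -rmorphD/= /l addrC subrK.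
  by rewrite cexpD invfM; ring.
rewrite E -[X in _ - X]mulr1 -mulrBr ComplexField.Normc.normcM mulrC.
rewrite ler_wpM2r ?normc_ge0//.
have -> : n.+2%:R * cexp (z * l%:C) / D - 1 =
  (n.+2%:R * (cexp (z * l%:C) - 1 - z * l%:C) + z * (n.+2%:R * l - 1)%:C) / D.
  have -> : (n.+2%:R * l - 1)%:C = n.+2%:R * l%:C - 1 :> R[i].
    by rewrite natr_complex -rmorphM -(rmorph1 (real_complex R)) -rmorphB.
  by apply: (mulIf D0); rewrite mulrBl !divfK// mul1r /D; ring.
rewrite ComplexField.Normc.normcM ComplexField.Normc.normcV.
rewrite ler_pdivrMr; last exact: lt_le_trans n2 nD.
apply: (@le_trans _ _ (n.+2%:R * ((K + normc z) / n.+1%:R ^+ 2))); last first.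
  rewrite mulrC ler_wpM2l// mulr_ge0 ?invr_ge0 ?sqr_ge0// addr_ge0//.
  exact: normc_ge0.
rewrite [X in _ <= _ * X]mulrDl [leRHS]mulrDr; apply: (le_trans (le_normcD _ _)).
rewrite !ComplexField.Normc.normcM natr_complex !normc_real (ger0_norm (ltW n2)).
apply: lerD.
  rewrite ler_wpM2l//; apply: (le_trans (hK l _)); first by rewrite l0.
  by rewrite ler_wpM2l// -exprVn ler_pXn2r// nnegrE invr_ge0.
rewrite mulrCA ler_wpM2l ?normc_ge0// ger0_norm; last first.
  by rewrite subr_ge0 mulrC -ler_pdivrMr// div1r.
have : n.+2%:R * l <= n.+2%:R / n.+1%:R by rewrite ler_wpM2l.
have -> : n.+2%:R / n.+1%:R = 1 + n.+1%:R^-1 :> R.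
  by rewrite nE mulrDl divff ?gt_eqF// mul1r.
rewrite -lerBlDl => /le_trans; apply.
rewrite expr2 invfM mulrA -[leLHS]mul1r ler_wpM2r ?invr_ge0//.
by rewrite ler_pdivlMr// mul1r nE lerDl.
Qed.

(** Euler's limit exists on the closed right half-plane because the relative
    increments are summable; on the imaginary axis it is needed at [2is]. *)
Lemma cvg_normc_Gamma a s : 0 <= a ->
  (fun n => normc (euler_seq n (a +i* s)) ^+ 2) @ \oo --> normc (Gamma (a +i* s)) ^+ 2.
Proof.
move=> a0; have [K hK] := euler_seq_increment s a0.
set z := a +i* s in hK *.
have [/cvg_ex[x cx] /cvg_ex[y cy]] := cvg_complex_product hK.
have GE : Gamma z = x +i* y.
  have H : (fun n => euler_seq n z : R[i]^o) @ \oo --> (x +i* y : R[i]^o).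
    rewrite -cvg_shiftS/=; exact: (@cvg_complex _ (fun n => euler_seq n.+1 z)).
  exact: (cvg_lim (@norm_hausdorff _ _) H).
rewrite GE sqr_normc2/=.
rewrite -cvg_shiftS/=; under eq_fun do rewrite sqr_normc2.
by apply: cvgD; under eq_fun do rewrite expr2; rewrite expr2; apply: cvgM.
Qed.

End GammaModulus.

(** * The weight as a quotient of infinite products *)

Section WeightFormula.
Variable R : realType.
Implicit Types (a s : R) (z : R[i]).

Lemma eq_cvg_lim (x y : nat -> R) (b c : R) : x =1 y ->
  x @ \oo --> b -> y @ \oo --> c -> b = c.
Proof. by move=> /funext -> xb xc; rewrite -(cvg_lim _ xb)// (cvg_lim _ xc). Qed.

Lemma sqr_normc_poch n a s :
  normc (poch (a +i* s) n) ^+ 2 = \prod_(j < n) ((a + j%:R) ^+ 2 + s ^+ 2).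
Proof.
elim: n => [|n IH]; first by rewrite /poch !big_ord0 ComplexField.Normc.normc1 expr1n.
rewrite pochS big_ord_recr/= ComplexField.Normc.normcM exprMn IH; congr (_ * _).
by rewrite natr_complex sqr_normc2 Re_add Im_add/= addr0.
Qed.

Lemma sumsq_gprod n a s : 0 < a ->
  \prod_(j < n) ((a + j%:R) ^+ 2 + s ^+ 2) =
  (\prod_(j < n) (a + j%:R) ^+ 2) * gprod n a s.
Proof.
move=> a0; rewrite /gprod -big_split/=; apply: eq_bigr => j _.
have aj : 0 < a + j%:R by rewrite ltr_wpDr.
by field; rewrite gt_eqF.
Qed.

Lemma sqr_normc_euler_seq n a s :
  normc (euler_seq n (a +i* s)) ^+ 2 =
  (n`!%:R * expR (a * ln n%:R)) ^+ 2 / \prod_(j < n.+1) ((a + j%:R) ^+ 2 + s ^+ 2).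
Proof.
rewrite /euler_seq ComplexField.Normc.normcM ComplexField.Normc.normcV.
rewrite ComplexField.Normc.normcM.
rewrite natr_complex normc_real normr_nat normc_cexp exprMn exprVn sqr_normc_poch.
by rewrite Re_mul/= mulr0 subr0.
Qed.

Lemma sqr_normc_Gamma a s : 0 < a ->
  normc (Gamma (a +i* s)) ^+ 2 = normc (Gamma a%:C) ^+ 2 / glim a s.
Proof.
move=> a0; apply: (@mulIf _ (glim a s)); first by rewrite gt_eqF// glim_gt0.
rewrite divfK ?gt_eqF ?glim_gt0//.
have cg : (fun n => gprod n.+1 a s) @ \oo --> glim a s.
  by rewrite (cvg_shiftS (fun n => gprod n a s)); exact: cvg_gprod.
have c1 := cvgM (@cvg_normc_Gamma R _ s (ltW a0)) cg.
have c2 := @cvg_normc_Gamma R _ 0 (ltW a0).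
apply: (eq_cvg_lim _ (c1 _) c2) => n /=.
rewrite !sqr_normc_euler_seq !sumsq_gprod//.
have -> : gprod n.+1 a 0 = 1.
  by rewrite /gprod big1// => j _; rewrite expr0n mul0r addr0.
by rewrite mulr1 invfM mulrA divfK// gt_eqF// gprod_gt0.
Qed.

(** The factors [1 + (2s)^2/(1 + j)^2] of even and odd index [j] are those of
    the products at [1/2] and at [1]. *)
Lemma glim_duplication s : glim 1 (2 * s) = glim 2^-1 s * glim 1 s.
Proof.
have E n : gprod (n.*2) 1 (2 * s) = gprod n 2^-1 s * gprod n 1 s.
  elim: n => [|n IH]; first by rewrite /gprod !big_ord0 mulr1.
  rewrite doubleS !gprodSr IH.
  rewrite -addnn -natr1 natrD.
  have n0 : 0 <= n%:R :> R by [].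
  set t : R := n%:R in n0 *.
  by field; rewrite !gt_eqF//; lra.
have c1 := @cvg_gprod R 1 (2 * s) ltr01.
have c2 : (fun n => gprod n.*2 1 (2 * s)) @ \oo --> glim 1 (2 * s).
  apply: (cvg_comp _ (fun n => gprod n 1 (2 * s)) _ c1).
  apply/cvgnyPge => A; near=> n.
  by rewrite (@leq_trans n) -?addnn ?leq_addr//; near: n; exact: nbhs_infty_ge.
have c3 : (fun n => gprod n.*2 1 (2 * s)) @ \oo --> glim 2^-1 s * glim 1 s.
  under eq_fun do rewrite E.
  by apply: cvgM; apply: cvg_gprod; rewrite ?invr_gt0.
exact: (eq_cvg_lim _ c2 c3).
Unshelve. all: by end_near. Qed.

Lemma sqr_normc_invGamma2i s :
  normc (invGamma2i s) ^+ 2 = 4 * s ^+ 2 * glim 2^-1 s * glim 1 s.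
Proof.
rewrite /invGamma2i; have [->|s0] := eqVneq s 0.
  by rewrite ComplexField.Normc.normc0 !expr0n/= mulr0 !mul0r.
have S0 : 0 < (2 * s) ^+ 2 by rewrite exprn_even_gt0//= mulf_neq0.
rewrite ComplexField.Normc.normcV exprVn -mulrA -glim_duplication.
have -> : 4 * s ^+ 2 = (2 * s) ^+ 2 by ring.
have cg := @cvg_gprod R 1 (2 * s) ltr01.
have c1 : (fun n => normc (euler_seq n (0 +i* (2 * s))) ^+ 2 *
      ((2 * s) ^+ 2 * gprod n 1 (2 * s))) @ \oo -->
    normc (Gamma (0 +i* (2 * s))) ^+ 2 * ((2 * s) ^+ 2 * glim 1 (2 * s)).
  by apply: cvgM; [exact: cvg_normc_Gamma|exact: cvgMl_tmp].
have c2 : (fun=> 1 : R) @ \oo --> (1 : R) by exact: cvg_cst.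
have E : normc (Gamma (0 +i* (2 * s))) ^+ 2 * ((2 * s) ^+ 2 * glim 1 (2 * s)) = 1.
  apply: (eq_cvg_lim _ c1 c2) => n /=.
  rewrite sqr_normc_euler_seq mul0r expR0 mulr1 big_ord_recl/= addr0 expr0n/= add0r.
  under eq_bigr do rewrite add0r /bump leq0n natrD.
  rewrite -[true%:R]/1 sumsq_gprod// prodrXl.
  have -> : \prod_(i < n) (1 + i%:R) = n`!%:R :> R.
    rewrite fact_prod natr_prod big_add1/= big_mkord.
    by apply: eq_bigr => i _; rewrite -natr1 addrC.
  have n0 : n`!%:R != 0 :> R by rewrite pnatr_eq0 -lt0n fact_gt0.
  have g0 : gprod n 1 (2 * s) != 0 by rewrite gt_eqF// gprod_gt0.
  by move: (gt_eqF S0) => /negbT S1; field; rewrite n0 g0.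
exact: mulr1_eq E.
Qed.

Definition weight (p u v q s : R) : R :=
  s ^+ 2 * glim 1 s * glim 2^-1 s * glim q s / (glim p s * glim u s * glim v s).

Lemma w1_weight p u v q : 0 < p -> 0 < u -> 0 < v -> 0 < q ->
  exists K : R, forall s, w1 p u v q s = K * weight p u v q s.
Proof.
move=> p0 u0 v0 q0.
exists (4 * pi^-1 * normc (Gamma p%:C) ^+ 2 * normc (Gamma u%:C) ^+ 2 *
  normc (Gamma v%:C) ^+ 2 / normc (Gamma q%:C) ^+ 2) => s.
have zE a : a%:C + s*i = a +i* s by simpc.
rewrite /w1 !zE !ComplexField.Normc.normcM ComplexField.Normc.normcV !exprMn exprVn.
rewrite (@sqr_normc_Gamma p s p0) (@sqr_normc_Gamma u s u0).
rewrite (@sqr_normc_Gamma v s v0) (@sqr_normc_Gamma q s q0).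
rewrite sqr_normc_invGamma2i /weight !invfM invrK.
by ring.
Qed.

End WeightFormula.

(** * Uniform bounds for the truncated weight *)

Section TruncatedWeight.
Variable R : realType.
Notation mu := (@lebesgue_measure R).
Implicit Types (a p u v q s : R) (z : R[i]).

(** Three lengths: [l] and [n] factors for the products at [1] and [1/2], [m]
    for that of [q]; the shift by one half produces [n = l.+1]. *)
Definition trunc_weight (l n m : nat) p u v q s : R :=
  s ^+ 2 * gprod l 1 s * gprod n 2^-1 s * gprod m q s /
  (gprod n p s * gprod n u s * gprod n v s).

(** The bound does not depend on the truncation because the product of [q] has
    [i3] factors fewer than the others: after lowering [q] to [v + i3], it
    cancels against the last factors of the product of [v]. Similarly [u] and
    [p] are raised to [1 + i1] and [1/2 + i2], in order to cancel against the
    products at [1] and [1/2]. *)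
Lemma trunc_weight_le p u v q (i1 i2 i3 e : nat) :
    0 < p -> 0 < u -> 0 < v -> 0 < q ->
    u <= 1 + i1%:R -> p <= 2^-1 + i2%:R -> v + i3%:R <= q ->
    (i1 + i2 + e <= i3)%N ->
  exists2 C : R, 0 <= C & forall l m s, (l <= m + i3)%N ->
    0 <= trunc_weight l (m + i3) m p u v q s <= C * (s ^+ 2 / oneDsqr s ^+ e).
Proof.
move=> p0 u0 v0 q0 hu hp hq hi.
have h20 : 0 < 2^-1 :> R by rewrite invr_gt0.
have vi0 : 0 < v + i3%:R by rewrite ltr_wpDr.
have [C1 C10 H1] := gprod_upper i1 (@ltr01 R).
have [C2 C20 H2] := gprod_upper i2 h20.
have [c3 c30 H3] := gprod_lower i3 v0.
exists (C1 * C2 / c3); first by rewrite !mulr_ge0 ?invr_ge0// ltW.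
move=> l m s lm; set n := (m + i3)%N in lm *.
have g0 k a : 0 <= gprod k a s by exact/ltW/gprod_gt0.
have gn k a : gprod k a s != 0 by rewrite gt_eqF// gprod_gt0.
have o0 : 0 < oneDsqr s by exact: oneDsqr_gt0.
apply/andP; split.
  by rewrite /trunc_weight; do ?[exact: sqr_ge0|exact: g0|rewrite invr_ge0|apply: mulr_ge0].
have b1 : gprod l 1 s <= (C1 * oneDsqr s ^+ i1) * gprod n u s.
  apply: (le_trans (gprod_nondecreasing 1 s lm)).
  apply: (le_trans (gprod_le_mul n s ltr01 u0 hu)).
  by rewrite ler_wpM2r.
have b2 : gprod n 2^-1 s <= (C2 * oneDsqr s ^+ i2) * gprod n p s.
  by apply: (le_trans (gprod_le_mul n s h20 p0 hp)); rewrite ler_wpM2r.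
have b3 : gprod m q s * (c3 * oneDsqr s ^+ i3) <= gprod n v s.
  rewrite /n addnC gprodD mulrC; apply: ler_pM => //.
    by rewrite mulr_ge0 ?exprn_ge0 ?ltW.
  exact: le_gprod.
rewrite /trunc_weight ler_pdivrMr ?mulr_gt0 ?gprod_gt0//.
have oE : oneDsqr s ^+ i1 * oneDsqr s ^+ i2 * oneDsqr s ^+ e <= oneDsqr s ^+ i3.
  by rewrite -!exprD ler_weXn2l// oneDsqr_ge1.
have c30' := gt_eqF c30; have oe0 : oneDsqr s ^+ e != 0 by rewrite expf_neq0// gt_eqF.
apply: (@le_trans _ _ (s ^+ 2 * ((C1 * oneDsqr s ^+ i1) * gprod n u s) *
   ((C2 * oneDsqr s ^+ i2) * gprod n p s) * gprod m q s)).
  apply: ler_wpM2r => //; apply: ler_pM => //; first by rewrite mulr_ge0 ?sqr_ge0.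
  by rewrite ler_wpM2l ?sqr_ge0.
have -> : C1 * C2 / c3 * (s ^+ 2 / oneDsqr s ^+ e) *
    (gprod n p s * gprod n u s * gprod n v s) =
  (s ^+ 2 * C1 * C2 * gprod n p s * gprod n u s / (c3 * oneDsqr s ^+ e)) * gprod n v s.
  by field; rewrite oe0 c30'.
have -> : s ^+ 2 * ((C1 * oneDsqr s ^+ i1) * gprod n u s) *
   ((C2 * oneDsqr s ^+ i2) * gprod n p s) * gprod m q s =
  (s ^+ 2 * C1 * C2 * gprod n p s * gprod n u s / (c3 * oneDsqr s ^+ e)) *
   (gprod m q s * (c3 * (oneDsqr s ^+ i1 * oneDsqr s ^+ i2 * oneDsqr s ^+ e))).
  by field; rewrite oe0 c30'.
apply: ler_wpM2l.
  by do ?[exact: sqr_ge0|exact: g0|exact: ltW|rewrite invr_ge0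
         |apply: mulr_ge0|apply: exprn_ge0].
apply: le_trans b3; rewrite ler_wpM2l// ler_wpM2l// ltW//.
Qed.

Lemma cvg_trunc_weight p u v q (j k : nat) s :
    0 < p -> 0 < u -> 0 < v -> 0 < q ->
  (fun m => trunc_weight (m + j) (m + k) m p u v q s) @ \oo --> weight p u v q s.
Proof.
move=> p0 u0 v0 q0.
have cg a i : 0 < a -> (fun m => gprod (m + i) a s) @ \oo --> glim a s.
  by move=> a0; rewrite (cvg_shiftn i (fun m => gprod m a s)); exact: cvg_gprod.
apply: cvgM; last first.
  apply: cvgV; first by rewrite !mulf_neq0// gt_eqF// glim_gt0.
  by apply: cvgM; [apply: cvgM|]; exact: cg.
apply: cvgM; last exact: cvg_gprod.
apply: cvgM; last by apply: cg; rewrite invr_gt0.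
by apply: cvgMl_tmp; exact: cg.
Qed.

End TruncatedWeight.

(** * The truncated weight on the shifted line *)

Section ShiftedLine.
Variable R : realType.
Notation mu := (@lebesgue_measure R).
Implicit Types (a p u v q s : R) (z : R[i]).

(** With [z = is], the odd function at [1/2 + z] is a constant times the weight
    times this product divided by [z]; for its truncation the factor
    [trunc_ratio], tending to [1], comes in addition. *)
Definition backward_factor p u v q s : R[i] :=
  (p +i* s) * (u +i* s) * (v +i* s) * ((q - 1) -i* s).

Definition trunc_ratio (n m : nat) p u v q s : R[i] :=
  ((2^-1 + n%:R) +i* s) * (n%:R +i* s) * ((q + m%:R) +i* s) /
  (((p + n%:R) +i* s) * ((u + n%:R) +i* s) * ((v + n%:R) +i* s)).

Lemma complex_shiftE a s : a%:C + (0 +i* s) = a +i* s.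
Proof. by simpc. Qed.

Lemma imag_neq0 a s : s != 0 -> a +i* s != 0.
Proof. by move=> s0; rewrite eq_complex/= negb_and s0 orbT. Qed.

Lemma half_weight_shift (l m : nat) p u v q s : s != 0 -> 0 < p -> 0 < u -> 0 < v ->
  let z := 0 +i* s in let n := l.+1 in
  half_weight n m p u v q (2^-1 +i* s) =
  sqprod n 2^-1 z * sqprod n 0 z * sqprod m q z /
    (sqprod n p z * sqprod n u z * sqprod n v z) *
  (backward_factor p u v q s * trunc_ratio n m p u v q s) / z.
Proof.
move=> s0 p0 u0 v0 z n.
have zE a : a%:C + z = a +i* s by rewrite complex_shiftE.
have nz a : a%:C + z != 0 by rewrite zE imag_neq0.
have z0 : z != 0 by exact: imag_neq0.
have H a k : sqprod k (a + 2^-1) (2^-1%:C + z) =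
    sqprod k a z * ((a + k%:R)%:C + z) / (a%:C + z).
  by rewrite -sqprod_half_shift mulfK.
rewrite -(zE 2^-1) /half_weight !H.
have -> : sqprod n 1 (2^-1%:C + z) =
    sqprod n 2^-1 z * ((2^-1 + n%:R)%:C + z) / (2^-1%:C + z).
  by rewrite -H; congr sqprod; rewrite [LHS]splitr div1r.
have -> : sqprod n 2^-1 (2^-1%:C + z) = sqprod n 0 z * (n%:R%:C + z) / z.
  by have := H 0 n; rewrite !add0r.
have -> : sqprod m.+1 (q - 2^-1) (2^-1%:C + z) =
    ((q - 1)%:C - z) * sqprod m q z * ((q + m%:R)%:C + z).
  rewrite (_ : q - 2^-1 = (q - 1) + 2^-1); last by lra.
  rewrite H sqprodS subrK.
  rewrite (_ : q - 1 + m.+1%:R = q + m%:R); last by rewrite -natr1; ring.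
  by apply: (mulIf (nz (q - 1))); rewrite divfK// subr_sqr; ring.
rewrite /backward_factor /trunc_ratio.
have -> : (q - 1) -i* s = (q - 1)%:C - z by rewrite /z; simpc.
rewrite -!zE.
have sq a : 0 < a -> sqprod n a z != 0.
  move=> a0; rewrite sqprod_imag; apply/eqP => /complexI/eqP; apply/negP.
  rewrite gt_eqF// prodr_gt0// => j _.
  by rewrite ltr_wpDr ?sqr_ge0// exprn_gt0// ltr_wpDr.
move: (sq p p0) (sq u u0) (sq v v0) (nz p) (nz u) (nz v) (nz 2^-1)
  (nz (p + n%:R)) (nz (u + n%:R)) (nz (v + n%:R)).
move: (sqprod n p z) (sqprod n u z) (sqprod n v z) => Sp Su Sv.
move: (sqprod n 2^-1 z) (sqprod n 0 z) (sqprod m q z) => Sh S0 Sq.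
move: ((p + n%:R)%:C + z) ((u + n%:R)%:C + z) ((v + n%:R)%:C + z) => np nu nv.
move: (p%:C + z) (u%:C + z) (v%:C + z) (2^-1%:C + z) => zp zu zv zh.
move=> *; field.
do ?[apply/andP; split]; by [].
Qed.

(** The quotient by [z = is] exchanges real and imaginary parts. *)
Lemma half_weight_line (l m : nat) p u v q : 0 < p -> 0 < u -> 0 < v -> 0 < q ->
  exists2 k : R, k != 0 & forall s,
  Re (half_weight l.+1 m p u v q (2^-1 +i* s)) =
  k * (trunc_weight l l.+1 m p u v q s *
       (Im (backward_factor p u v q s * trunc_ratio l.+1 m p u v q s) / s)).
Proof.
move=> p0 u0 v0 q0; set n := l.+1.
have h20 : 0 < 2^-1 :> R by rewrite invr_gt0.
pose c k a : R := \prod_(j < k) (a + j%:R) ^+ 2.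
have c0 k a : 0 < a -> c k a != 0.
  move=> a0; rewrite gt_eqF// prodr_gt0// => j _.
  by rewrite exprn_gt0// ltr_wpDr.
exists (c n 2^-1 * c l 1 * c m q / (c n p * c n u * c n v)).
  by rewrite !(mulf_neq0, invr_eq0)// c0.
(* At [s = 0] the first factor of [sqprod n 2^-1] is zero, and so is the
   right-hand side, as a quotient by zero. *)
move=> s; have [->|s0] := eqVneq s 0.
  have -> : half_weight n m p u v q (2^-1 +i* 0) = 0.
    rewrite /half_weight /n [sqprod l.+1 2^-1 _]sqprodS.
    by rewrite -[2^-1 +i* 0]/(2^-1%:C) subrr mul0r mulr0 !mul0r.
  by rewrite invr0 !mulr0.
rewrite half_weight_shift// !sqprod_imag -/n.
have cE k a : \prod_(j < k) (a + j%:R) ^+ 2 = c k a by [].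
have -> : \prod_(j < n) ((0 + j%:R) ^+ 2 + s ^+ 2) = s ^+ 2 * (c l 1 * gprod l 1 s).
  rewrite /n big_ord_recl/= addr0 expr0n/= add0r; congr (_ * _).
  rewrite -cE -sumsq_gprod//; apply: eq_bigr => j _.
  by rewrite add0r /bump leq0n natrD.
rewrite !sumsq_gprod// !cE.
set X := backward_factor _ _ _ _ _ * _.
set A := c n 2^-1 * _; set B := s ^+ 2 * _; set D := c m q * _.
set E := c n p * _; set F := c n u * _; set G := c n v * _.
have -> : A%:C * B%:C * D%:C / (E%:C * F%:C * G%:C) * X / (0 +i* s) =
    (A * B * D / (E * F * G))%:C * (X / (0 +i* s)).
  by rewrite -!rmorphM -fmorphV -rmorphM/= mulrA.
have -> : X / (0 +i* s) = Im X / s -i* (Re X / s).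
  have s0' := imag_neq0 0 s0.
  apply: (mulIf s0'); rewrite divfK//; case: (X) => x y; simpc => /=.
  by congr (_ +i* _); field.
rewrite Re_mul/= mul0r subr0 mulrA /trunc_weight -/n; congr (_ * (_ / _)).
rewrite /A /B /D /E /F /G.
have gn k a : gprod k a s != 0 by rewrite gt_eqF// gprod_gt0.
move: (gn n p) (gn n u) (gn n v) (c0 n p p0) (c0 n u u0) (c0 n v v0) => *.
by field; do ?[apply/andP; split].
Qed.

End ShiftedLine.

Section TruncatedRatio.
Variable R : realType.
Notation mu := (@lebesgue_measure R).
Implicit Types (a p u v q s x y : R) (z : R[i]).

Lemma normc_line_le a s :
  normc (a +i* s) <= (1 + `|a|) * Num.sqrt (oneDsqr s).
Proof.
have a1 : 0 <= 1 + `|a| by rewrite addr_ge0.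
rewrite -(@ler_pXn2r _ 2)// ?nnegrE ?normc_ge0 ?mulr_ge0 ?sqrtr_ge0//.
rewrite sqr_normc2 exprMn sqr_sqrt_oneDsqr /oneDsqr /=.
rewrite -[a ^+ 2]real_normK ?num_real//.
have := normr_ge0 a; move: `|a| => b b0; have := sqr_ge0 s; move: (s ^+ 2) => t t0.
nra.
Qed.

Lemma normc_line_le2 x y s : 0 <= x -> x <= 2 * y ->
  normc (x +i* s) <= 2 * normc (y +i* s).
Proof.
move=> x0 xy.
rewrite -(@ler_pXn2r _ 2)// ?nnegrE ?normc_ge0 ?mulr_ge0 ?normc_ge0//.
rewrite exprMn !sqr_normc2/=; have := sqr_ge0 s; nra.
Qed.

Lemma normc_backward_factor p u v q : exists2 C : R, 0 <= C &
  forall s, normc (backward_factor p u v q s) <= C * oneDsqr s ^+ 2.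
Proof.
exists ((1 + `|p|) * (1 + `|u|) * (1 + `|v|) * (1 + `|q - 1|)).
  by rewrite !mulr_ge0// addr_ge0.
move=> s; rewrite /backward_factor !ComplexField.Normc.normcM.
have wE : oneDsqr s ^+ 2 = Num.sqrt (oneDsqr s) ^+ 4.
  by rewrite -{1}sqr_sqrt_oneDsqr -exprM.
rewrite wE; set w := Num.sqrt (oneDsqr s).
have -> : (1 + `|p|) * (1 + `|u|) * (1 + `|v|) * (1 + `|q - 1|) * w ^+ 4 =
  ((1 + `|p|) * w) * ((1 + `|u|) * w) * ((1 + `|v|) * w) * ((1 + `|q - 1|) * w) by ring.
have b a := normc_line_le a s.
have bq : normc ((q - 1) -i* s) <= (1 + `|q - 1|) * w.
  by have := normc_line_le (q - 1) (- s); rewrite /w /oneDsqr sqrrN.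
do ?[apply: ler_pM]; rewrite ?normc_ge0 ?mulr_ge0 ?normc_ge0//; exact: b.
Qed.

Lemma normc_trunc_ratio (n m : nat) p u v q s :
    0 < p -> 0 < u -> 0 < v -> 0 < q -> (0 < n)%N ->
    q + m%:R <= 2 * (v + n%:R) ->
  normc (trunc_ratio n m p u v q s) <= 8.
Proof.
move=> p0 u0 v0 q0 n0 hq.
have n1 : 1 <= n%:R :> R by rewrite ler1n.
rewrite /trunc_ratio ComplexField.Normc.normcM ComplexField.Normc.normcV.
have pos a : 0 < a -> 0 < normc ((a + n%:R) +i* s).
  move=> a0; apply: lt_le_trans (Re_le_normc _) => /=.
  by rewrite ger0_norm ?addr_ge0 ?(ltW a0)// ltr_wpDr.
rewrite !ComplexField.Normc.normcM ler_pdivrMr ?mulr_gt0 ?pos//.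
have h1 : normc ((2^-1 + n%:R) +i* s) <= 2 * normc ((u + n%:R) +i* s).
  by apply: normc_line_le2; rewrite ?addr_ge0 ?invr_ge0//; lra.
have h2 : normc (n%:R +i* s) <= 2 * normc ((p + n%:R) +i* s).
  by apply: normc_line_le2 => //; lra.
have h3 : normc ((q + m%:R) +i* s) <= 2 * normc ((v + n%:R) +i* s).
  by apply: normc_line_le2 => //; rewrite addr_ge0// ltW.
have -> : 8 * (normc ((p + n%:R) +i* s) * normc ((u + n%:R) +i* s) *
    normc ((v + n%:R) +i* s)) =
  (2 * normc ((u + n%:R) +i* s)) * (2 * normc ((p + n%:R) +i* s)) *
  (2 * normc ((v + n%:R) +i* s)) by ring.
by do ?[apply: ler_pM]; rewrite ?normc_ge0 ?mulr_ge0 ?normc_ge0.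
Qed.

(** Convergence through components, which multiplies without any reference to
    a topology on the complex numbers. *)
Definition ccvg (x : nat -> R[i]) z : Prop :=
  (fun n => Re (x n)) @ \oo --> Re z /\ (fun n => Im (x n)) @ \oo --> Im z.

Lemma ccvg_cst z : ccvg (fun=> z) z.
Proof. by split; exact: cvg_cst. Qed.

Lemma ccvgM (x y : nat -> R[i]) z w : ccvg x z -> ccvg y w ->
  ccvg (fun n => x n * y n) (z * w).
Proof.
move=> [x1 x2] [y1 y2]; split.
  by under eq_fun do rewrite Re_mul; rewrite Re_mul; apply: cvgB; apply: cvgM.
by under eq_fun do rewrite Im_mul; rewrite Im_mul; apply: cvgD; apply: cvgM.
Qed.

Lemma cvg_inv_addn a : (fun m => (a + m%:R)^-1 : R) @ \oo --> (0 : R).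
Proof.
apply/cvgrPdist_le => e e0; near=> m.
have h : e^-1 - a <= m%:R by near: m; exact: nbhs_infty_ger.
have ei : 0 < e^-1 by rewrite invr_gt0.
have am : 0 < a + m%:R by lra.
rewrite sub0r normrN ger0_norm ?invr_ge0 ?(ltW am)//.
rewrite -[leRHS]invrK lef_pV2 ?posrE//; lra.
Unshelve. all: by end_near. Qed.

(** The difference with [1] is [(x - y) / ((y + m) + is)]. *)
Lemma ccvg_line_ratio x y s :
  ccvg (fun m => ((x + m%:R) +i* s) / ((y + m%:R) +i* s)) 1.
Proof.
have cV : (fun m => (`|(y + m%:R)^-1| : R)) @ \oo --> (0 : R).
  by rewrite -(@normr0 _ R); apply: cvg_norm; exact: cvg_inv_addn.
have near_pos : \forall m \near \oo, 0 < y + m%:R.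
  near=> m; have h : 1 - y <= m%:R by near: m; exact: nbhs_infty_ger.
  lra.
have E : \forall m \near \oo, 
   ((x + m%:R) +i* s) / ((y + m%:R) +i* s) - 1 = (x - y)%:C / ((y + m%:R) +i* s) /\
   normc ((x - y)%:C / ((y + m%:R) +i* s)) <= `|x - y| * `|(y + m%:R)^-1|.
  near=> m; have ym : 0 < y + m%:R by near: m.
  have nz : (y + m%:R) +i* s != 0.
    by rewrite eq_complex/= negb_and gt_eqF.
  split.
    apply: (mulIf nz); rewrite mulrBl !divfK// mul1r.
    by apply/eqP; rewrite eq_complex/= addrN eqxx andbT; apply/eqP; ring.
  rewrite ComplexField.Normc.normcM ComplexField.Normc.normcV normc_real.
  rewrite ler_wpM2l// normfV lef_pV2 ?posrE ?normr_gt0 ?gt_eqF//.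
    exact: (le_trans _ (Re_le_normc _)).
  by apply: lt_le_trans (Re_le_normc _); rewrite /= normr_gt0 gt_eqF.
have cB : (fun m => `|x - y| * `|(y + m%:R)^-1|) @ \oo --> (0 : R).
  by rewrite -[0](mulr0 `|x - y|); exact: cvgMl_tmp.
have cBN : (fun m => - (`|x - y| * `|(y + m%:R)^-1|)) @ \oo --> (0 : R).
  by rewrite -[0 in X in _ --> X]oppr0; exact: cvgN.
split.
  apply: cvg_zero; rewrite -[X in _ --> X]/(0 : R).
  apply: (squeeze_cvgr _ cBN cB); apply: filterS E => m [e1 e2].
  rewrite -ler_norml; apply: (le_trans _ e2); rewrite -e1.
  by apply: (le_trans _ (Re_le_normc _)); rewrite Re_add Re_opp.
rewrite [Im 1]/=.
apply: (squeeze_cvgr _ cBN cB); apply: filterS E => m [e1 e2].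
rewrite -ler_norml; apply: (le_trans _ e2); rewrite -e1.
by apply: (le_trans _ (Im_le_normc _)); rewrite Im_add Im_opp/= subr0.
Unshelve. all: by end_near. Qed.

Lemma ccvg_trunc_ratio (k : nat) p u v q s :
  ccvg (fun m => trunc_ratio (m + k) m p u v q s) 1.
Proof.
have h a b : ccvg (fun m => ((a + m%:R) +i* s) / ((b + (m + k)%:R) +i* s)) 1.
  have := ccvg_line_ratio a (b + k%:R) s.
  by under [X in ccvg X]eq_fun do rewrite -addrA -natrD addnC.
have h' a b : ccvg (fun m => ((a + (m + k)%:R) +i* s) / ((b + (m + k)%:R) +i* s)) 1.
  have := h (a + k%:R) b.
  by under [X in ccvg X]eq_fun do rewrite -addrA -natrD addnC.
have := ccvgM (ccvgM (h' 2^-1 u) (h' 0 p)) (h q v).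
rewrite !mulr1; congr ccvg; apply/funext => m; rewrite /trunc_ratio.
by rewrite add0r !invfM; ring.
Qed.

End TruncatedRatio.

(** * The first moment relation *)

Section FirstMoment.
Variable R : realType.
Notation mu := (@lebesgue_measure R).
Implicit Types (a p u v q s x y : R) (z : R[i]).

Lemma cvg_Rintegral_quadratic_decay (f_ : nat -> R -> R) (f : R -> R) (C : R) :
    (forall m, measurable_fun (`[0, +oo[%classic : set R) (f_ m)) ->
    (forall s, 0 <= s -> (fun m => f_ m s) @ \oo --> f s) ->
    (forall m s, 0 <= s -> `|f_ m s| <= C / oneDsqr s) ->
  mu.-integrable `[0, +oo[ (EFin \o f) /\
  (fun m => \int[mu]_(s in `[0, +oo[) f_ m s) @ \oo --> \int[mu]_(s in `[0, +oo[) f s.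
Proof.
move=> mf_ ff f_le.
have mD : measurable (`[0, +oo[%classic : set R) by exact: measurable_itv.
have mf : measurable_fun (`[0, +oo[%classic : set R) f.
  apply: (@measurable_fun_cvg _ _ _ _ f_) => // s /=.
  by rewrite in_itv/= andbT; exact: ff.
have inD s : (`[0, +oo[%classic : set R) s -> 0 <= s by rewrite /= in_itv/= andbT.
have [||If _ cf] := @dominated_convergence _ _ _ mu _ mD
  (fun m s => (f_ m s)%:E) (fun s => (f s)%:E) (fun s => (C / oneDsqr s)%:E)
  (fun m => (measurable_EFinP _ _).2 (mf_ m)) ((measurable_EFinP _ _).2 mf) _
  (integrable_oneDsqrV C) _.
- by apply: aeW => s /inD s0; apply: cvg_EFin; [exact: nearW|exact: ff].
- by apply: aeW => s m /inD s0; rewrite lee_fin; exact: f_le.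
split=> //; apply: fine_cvg; rewrite /Rintegral fineK//.
exact: integrable_fin_num.
Qed.

(** The integer parts [i1 <= u] and [i2 <= p + 1/2], with [q - v < i3 + 1],
    give [i1 + i2 + e < i3 + 1]. *)
Lemma truncation_indices p u v q (e : nat) : 0 < p -> 0 < u -> 0 < v ->
    e%:R + 2^-1 <= q - p - u - v ->
  exists i1 i2 i3 : nat, [/\ u <= 1 + i1%:R, p <= 2^-1 + i2%:R,
    v + i3%:R <= q, q <= v + i3%:R + 1 & (i1 + i2 + e <= i3)%N].
Proof.
move=> p0 u0 v0 he.
have e0 : 0 <= e%:R :> R by [].
have h1 := truncn_itv (ltW u0).
have h2 := @truncn_itv _ (p + 2^-1) _.
have h3 := @truncn_itv _ (q - v) _.
have {h2}/andP[h21 h22] : (Num.truncn (p + 2^-1))%:R <= p + 2^-1 < (Num.truncn (p + 2^-1)).+1%:R.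
  by apply: h2; lra.
have {h3}/andP[h31 h32] : (Num.truncn (q - v))%:R <= q - v < (Num.truncn (q - v)).+1%:R.
  by apply: h3; lra.
have /andP[h11 h12] := h1.
move: h11 h12 h21 h22 h31 h32.
move: (Num.truncn u) (Num.truncn (p + 2^-1)) (Num.truncn (q - v)) => i1 i2 i3.
rewrite -(@natr1 _ i1) -(@natr1 _ i2) -(@natr1 _ i3) => *.
exists i1, i2, i3; split; [lra|lra|lra|lra|].
by rewrite -ltnS -(ltr_nat R) -(@natr1 _ i3) !natrD; lra.
Qed.

Lemma weight_truncations p u v q (e : nat) : 0 < p -> 0 < u -> 0 < v ->
    (2 <= e)%N -> e%:R + 2^-1 <= q - p - u - v ->
  exists k : nat, [/\ v + k.+2%:R <= q, q <= v + k.+2%:R + 1, (e <= k.+2)%N &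
  exists2 C : R, 0 <= C & forall m s,
    0 <= trunc_weight (m + k.+1) (m + k.+2) m p u v q s <=
      C * (s ^+ 2 / oneDsqr s ^+ e)].
Proof.
move=> p0 u0 v0 e2 he.
have [i1 [i2 [[|[|k]] [h1 h2 h3 h4 h5]]]] := truncation_indices p0 u0 v0 he.
- by have := leq_trans e2 (leq_trans (leq_addl _ _) h5).
- by have := leq_trans e2 (leq_trans (leq_addl _ _) h5).
exists k; split => //; first exact: leq_trans (leq_addl _ _) h5.
have q0 : 0 < q by apply: lt_le_trans h3; rewrite ltr_wpDr.
have [C C0 HC] := trunc_weight_le p0 u0 v0 q0 h1 h2 h3 h5.
by exists C => // m s; apply: HC; rewrite leq_add2l.
Qed.

Lemma measurable_trunc_weight (l n m : nat) p u v q :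
  measurable_fun setT (trunc_weight l n m p u v q).
Proof.
apply: continuous_measurable_fun => s.
have cg k a := @continuous_gprod R k a.
apply: cvgM; last first.
  apply: cvgV; first by rewrite !mulf_neq0// gt_eqF// gprod_gt0.
  by apply: cvgM; [apply: cvgM|]; exact: cg.
apply: cvgM; last exact: cg.
apply: cvgM; last exact: cg.
apply: cvgM; last exact: cg.
exact: exprn_continuous.
Qed.

(** The truncations are dominated by [s^2/(1 + s^2)^2], hence by
    [1/(1 + s^2)]. *)
Lemma integrable_weight p u v q : 0 < p -> 0 < u -> 0 < v ->
    3 <= q - p - u - v ->
  mu.-integrable `[0, +oo[ (EFin \o weight p u v q).
Proof.
move=> p0 u0 v0 hq; have q0 : 0 < q by lra.
have he : 2%:R + 2^-1 <= q - p - u - v by lra.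
have [k [h3 h4 _ [C C0 HC]]] := weight_truncations p0 u0 v0 (leqnn 2) he.
have [] // := @cvg_Rintegral_quadratic_decay
  (fun m => trunc_weight (m + k.+1) (m + k.+2) m p u v q) (weight p u v q) C.
- by move=> m; apply: measurable_funTS; exact: measurable_trunc_weight.
- by move=> s _; exact: cvg_trunc_weight.
- move=> m s _; have /andP[w0 w1] := HC m s.
  rewrite ger0_norm//; apply: (le_trans w1); rewrite ler_wpM2l//.
  have o0 := oneDsqr_gt0 s.
  rewrite expr2 invfM mulrA ler_piMl ?invr_ge0 ?(ltW o0)//.
  by rewrite ler_pdivrMr// mul1r /oneDsqr lerDr.
Qed.

Lemma Im_backward_factor p u v q s :
  Im (backward_factor p u v q s) =
  s * ((p * u + p * v + u * v) * (q - 1) - p * u * v - (q - 1 - p - u - v) * s ^+ 2).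
Proof. by rewrite /backward_factor !(Im_mul, Re_mul)/=; ring. Qed.

(** The truncated identities [intK] come from the contour shift; the integrand
    converges to the weight times the imaginary part of [backward_factor]
    divided by [s]. Four of the powers of [1 + s^2] in the bound of the
    truncated weight are consumed: two by [backward_factor], one by
    [s = s^2/s], and one is left for integrability. *)
Lemma integral_weight_moment p u v q : 0 < p -> 0 < u -> 0 < v ->
    5 <= q - p - u - v ->
  \int[mu]_(s in `[0, +oo[) (weight p u v q s *
    ((p * u + p * v + u * v) * (q - 1) - p * u * v - (q - 1 - p - u - v) * s ^+ 2)) = 0.
Proof.
move=> p0 u0 v0 hq; have q0 : 0 < q by lra.
have he : 4%:R + 2^-1 <= q - p - u - v by lra.
have e2 : (2 <= 4)%N by [].
have [[|k] [h3 h4 // _ [C C0 HC]]] := weight_truncations p0 u0 v0 e2 he.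
have [C' C'0 HC'] := normc_backward_factor p u v q.
pose W m := trunc_weight (m + k.+2) (m + k.+2).+1 m p u v q.
pose K m s := W m s *
  (Im (backward_factor p u v q s * trunc_ratio (m + k.+2).+1 m p u v q s) / s).
pose I (f : R -> R) := \int[mu]_(s in `[0, +oo[) f s.
have addn_shift m : ((m + k.+2).+1 = m + k.+3)%N by rewrite -addnS.
have WE m s : 0 <= W m s <= C * (s ^+ 2 / oneDsqr s ^+ 4).
  by rewrite /W addn_shift; exact: HC.
have KE m : exists2 c : R, c != 0 & forall s, K m s =
    c * Re (half_weight (m.+1 + k.+2) m p u v q (2^-1 +i* s)).
  have [c c0 Hc] := @half_weight_line R (m + k.+2) m p u v q p0 u0 v0 q0.
  by exists c^-1; rewrite ?invr_eq0// => s; rewrite addSn Hc mulKf.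
have mK m : measurable_fun (`[0, +oo[%classic : set R) (K m).
  have [c c0 /funext ->] := KE m.
  apply: measurable_funTS; apply: continuous_measurable_fun => s.
  by apply: cvgMl_tmp; exact: continuous_half_weight.
have intK m : I (K m) = 0.
  have [c c0 /funext ->] := KE m.
  rewrite /I RintegralZl ?integral_half_weight_eq0 ?mulr0//.
  exact: integrable_half_weight.
pose f s := weight p u v q s *
    ((p * u + p * v + u * v) * (q - 1) - p * u * v - (q - 1 - p - u - v) * s ^+ 2).
have [||_] := @cvg_Rintegral_quadratic_decay K f (C * (8 * C')) mK.
- move=> s s0; have [->|sN0] := eqVneq s 0.
    rewrite /f /weight expr0n !mul0r/=.
    under eq_fun do rewrite /K /W /trunc_weight expr0n !mul0r/=.
    exact: cvg_cst.
  apply: cvgM; first by rewrite /W; under eq_fun do rewrite addn_shift; exact: cvg_trunc_weight.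
  have -> : (p * u + p * v + u * v) * (q - 1) - p * u * v - (q - 1 - p - u - v) * s ^+ 2
      = Im (backward_factor p u v q s * 1) / s.
    by rewrite mulr1 Im_backward_factor [RHS]mulrC mulKf.
  apply: cvgMr_tmp.
  have := ccvgM (ccvg_cst (backward_factor p u v q s)) (ccvg_trunc_ratio k.+3 p u v q s).
  by move=> []; under [X in _ -> X @ _ --> _ -> _]eq_fun do rewrite -addn_shift.
- move=> m s s0; have /andP[w0 w1] := WE m s.
  rewrite /K normrM (ger0_norm w0).
  have o1 := oneDsqr_ge1 s; have o0 := oneDsqr_gt0 s.
  have [->|sN0] := eqVneq s 0.
    by rewrite invr0 mulr0 normr0 mulr0 divr_ge0 ?mulr_ge0// ltW// oneDsqr_gt0.
  have sp : 0 < s by rewrite lt_neqAle eq_sym sN0.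
  have b : `|Im (backward_factor p u v q s * trunc_ratio (m + k.+2).+1 m p u v q s) / s|
      <= C' * oneDsqr s ^+ 2 * 8 / s.
    rewrite normrM normfV (ger0_norm s0) ler_wpM2r ?invr_ge0//.
    apply: (le_trans (Im_le_normc _)); rewrite ComplexField.Normc.normcM.
    apply: ler_pM; rewrite ?normc_ge0//.
    apply: normc_trunc_ratio => //.
    by rewrite addn_shift !natrD; move: h4; have : 0 <= m%:R :> R by []; lra.
  apply: (@le_trans _ _ (C * (s ^+ 2 / oneDsqr s ^+ 4) * (C' * oneDsqr s ^+ 2 * 8 / s))).
    by apply: ler_pM.
  have -> : C * (s ^+ 2 / oneDsqr s ^+ 4) * (C' * oneDsqr s ^+ 2 * 8 / s) =
    C * (8 * C') / oneDsqr s * (s / oneDsqr s).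
    by field; rewrite sN0 gt_eqF.
  rewrite ler_piMr ?divr_ge0 ?mulr_ge0 ?(ltW o0)//.
  by rewrite ler_pdivrMr// mul1r /oneDsqr; nra.
rewrite -/(I f) => cI; apply: (cvg_unique _ cI) => //.
by rewrite (_ : (fun m => _) = fun=> 0) //; [exact: cvg_cst|exact/funext].
Qed.

End FirstMoment.

(** * A terminating balanced sum *)

Section FiniteDifferences.
Variable R : idomainType.

(** Writing [P = Q * X + c], the constant contributes [(1 - 1)^n], and
    [i 'C(n, i) = n 'C(n - 1, i - 1)] reduces the rest to [Q(X + 1)]. *)
Lemma alternating_binomial_sum n (P : {poly R}) : (size P <= n)%N ->
  \sum_(i < n.+1) (-1) ^+ i * 'C(n, i)%:R * P.[i%:R] = 0.
Proof.
elim: n P => [|n IH] P.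
  rewrite leqn0 size_poly_eq0 => /eqP ->.
  by rewrite big1// => i _; rewrite horner0 mulr0.
elim/poly_ind: P => [|P c _].
  by move=> _; rewrite big1// => i _; rewrite horner0 mulr0.
move=> sP; have {}sP : (size P <= n)%N.
  move: sP; rewrite size_MXaddC; case: ifP => [/andP[/eqP -> _]|_]; first by rewrite size_poly0.
  by rewrite ltnS.
under eq_bigr do rewrite hornerMXaddC mulrDr.
rewrite big_split/= -mulr_suml [X in _ + X * _](_ : _ = 0) ?mul0r ?addr0; last first.
  have := exprDn (1 : R) (-1) n.+1; rewrite subrr expr0n/= => E; apply: etrans (esym E).
  by apply: eq_bigr => i _; rewrite expr1n mul1r mulr_natr.
rewrite big_ord_recl/= !mulr0 add0r.
have sQ : (size (P \Po ('X + 1%:P)) <= n)%N.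
  by rewrite size_comp_poly2// size_XaddC.
transitivity (- n.+1%:R * \sum_(i < n.+1) (-1) ^+ i * 'C(n, i)%:R *
    (P \Po ('X + 1%:P)).[i%:R]); last by rewrite IH// mulr0.
rewrite mulr_sumr; apply: eq_bigr => i _.
rewrite horner_comp hornerD hornerX hornerC natr1 /bump leq0n add1n exprS.
have := mul_bin_diag n.+1 i => /= /(congr1 (fun k => k%:R : R)); rewrite !natrM => E.
rewrite -[in LHS]mulrA [P.[_] * _]mulrC (mulrA _ _ P.[_]) [_ * i.+1%:R]mulrC -E.
ring.
Qed.

End FiniteDifferences.

Section Pochhammer.
Variable F : fieldType.
Implicit Types x y : F.

Lemma pochD x i k : poch x (i + k) = poch x i * poch (x + i%:R) k.
Proof.
rewrite /poch big_split_ord/=; congr (_ * _).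
by apply: eq_bigr => j _; rewrite natrD addrA.
Qed.

Lemma poch_cross x i j : poch x j * poch (x + j%:R) i = poch x i * poch (x + i%:R) j.
Proof. by rewrite -!pochD addnC. Qed.

Definition poch_poly x k : {poly F} := \prod_(j < k) ('X + (x + j%:R)%:P).

Lemma horner_poch_poly x k (t : F) : (poch_poly x k).[t] = poch (x + t) k.
Proof.
rewrite /poch_poly /poch horner_prod; apply: eq_bigr => j _.
by rewrite hornerD hornerX hornerC addrCA addrA addrC addrA.
Qed.

Lemma size_poch_poly x k : size (poch_poly x k) = k.+1.
Proof.
rewrite /poch_poly; elim: k => [|k IH]; first by rewrite big_ord0 size_poly1.
rewrite big_ord_recr/= size_Mmonic ?monicXaddC//; last first.
  by rewrite -size_poly_gt0 IH.
by rewrite IH size_XaddC addn2.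
Qed.

Lemma poch_neg n i : (i <= n)%N ->
  poch (- n%:R : F) i = (-1) ^+ i * 'C(n, i)%:R * i`!%:R.
Proof.
elim: i => [|i IH] lin; first by rewrite /poch big_ord0 expr0 bin0 fact0 !mul1r.
rewrite pochS IH 1?ltnW//.
have E : i.+1%:R * 'C(n, i.+1)%:R = (n%:R - i%:R) * 'C(n, i)%:R :> F.
  by rewrite -natrB 1?ltnW// -!natrM mul_bin_left.
rewrite factS natrM exprS.
have -> : - n%:R + i%:R = - (n%:R - i%:R) :> F by rewrite opprB addrC.
transitivity (- ((-1) ^+ i * i`!%:R * ((n%:R - i%:R) * 'C(n, i)%:R) : F)); first by ring.
by rewrite -E; ring.
Qed.

(** The terminating balanced sum that Saalschutz's theorem evaluates to
    zero: the two Pochhammer quotients are polynomials in the summation index,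
    of total degree [n - 1], so that the sum is an [n]-th difference of a
    polynomial of smaller degree. *)
Lemma saalschutz_zero (x y : F) (n j : nat) : (j < n)%N ->
    (forall k, poch x k != 0) ->
    (forall i, (i <= n)%N -> poch (y + j%:R) i != 0) ->
    (forall i, (i <= n)%N -> i`!%:R != 0 :> F) ->
  \sum_(i < n.+1) poch (- n%:R) i * poch (n%:R + y - 1) i / i`!%:R *
     poch (x + i%:R) (n - i) * poch (x + j%:R) i / poch (y + j%:R) i = 0.
Proof.
move=> jn x0 y0 f0; pose r := (n.-1 - j)%N.
have n0 : (0 < n)%N := leq_ltn_trans (leq0n j) jn.
have nE : (j + r).+1 = n by rewrite /r subnKC ?prednK// -ltnS prednK.
have r_le : (r <= n)%N by rewrite -nE ltnW// ltnS leq_addl.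
have yE : n%:R + y - 1 = (y + j%:R) + r%:R.
  have -> : n%:R = j%:R + r%:R + 1 :> F by rewrite -nE -addn1 !natrD.
  ring.
clearbody r.
transitivity (poch x n / poch x j / poch (y + j%:R) r *
  \sum_(i < n.+1) (-1) ^+ i * 'C(n, i)%:R *
     (poch_poly x j * poch_poly (y + j%:R) r).[i%:R]).
  rewrite mulr_sumr; apply: eq_bigr => i _.
  have lin : (i <= n)%N by rewrite -ltnS.
  rewrite poch_neg// yE hornerM !horner_poch_poly.
  have e1 : poch x n = poch x i * poch (x + i%:R) (n - i).
    by rewrite -pochD subnKC.
  have e2 := poch_cross x i j.
  have e3 := poch_cross (y + j%:R) i r.
  have h1 := x0 i; have h2 := x0 j; have h3 := y0 i lin; have h4 := y0 r r_le.
  have h5 := f0 i lin.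
  rewrite e1.
  have -> : poch (x + j%:R) i = poch x i * poch (x + i%:R) j / poch x j.
    by rewrite -e2 mulrC mulKf.
  have -> : poch (y + j%:R + r%:R) i =
      poch (y + j%:R) i * poch (y + j%:R + i%:R) r / poch (y + j%:R) r.
    by rewrite -e3 mulrC mulKf.
  by field; rewrite h2 h3 h4 h5.
rewrite alternating_binomial_sum ?mulr0//.
rewrite size_mul -?size_poly_gt0 ?size_poch_poly//.
by rewrite addSn addnS nE.
Qed.

End Pochhammer.

(** * Moments of the weight and orthogonality *)

Section WilsonReal.
Variable R : realType.
Notation mu := (@lebesgue_measure R).
Implicit Types (p u v q a b s : R).

Definition sumsq_prod k a s : R := \prod_(j < k) ((a + j%:R) ^+ 2 + s ^+ 2).

Lemma sumsq_prodSr k a s :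
  sumsq_prod k.+1 a s = sumsq_prod k a s * ((a + k%:R) ^+ 2 + s ^+ 2).
Proof. by rewrite /sumsq_prod big_ord_recr. Qed.

Lemma poch_real (x : R) k : poch (x%:C : R[i]) k = (poch x k)%:C.
Proof.
by rewrite /poch rmorph_prod; apply: eq_bigr => j _; rewrite rmorphD/= natr_complex.
Qed.

Lemma poch_conj a s k :
  poch (a%:C + s*i) k * poch (a%:C - s*i) k = (sumsq_prod k a s)%:C.
Proof.
rewrite /poch /sumsq_prod -big_split rmorph_prod/=; apply: eq_bigr => j _.
rewrite natr_complex; simpc.
by congr (_ +i* _); ring.
Qed.

Definition wilson_coef n p u v d i : R :=
  poch (- n%:R) i * poch (n%:R + (p + u + v + d) - 1) i / i`!%:R *
  (poch (p + u + i%:R) (n - i) * poch (p + v + i%:R) (n - i) *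
   poch (p + d + i%:R) (n - i)).

(** The conjugate products [(p + is)_i (p - is)_i] are real. *)
Lemma wilsonE n p u v d s : wilson n p%:C u%:C v%:C d%:C s =
  (\sum_(i < n.+1) wilson_coef n p u v d i * sumsq_prod i p s)%:C.
Proof.
rewrite /wilson rmorph_sum; apply: eq_bigr => i _.
rewrite -[X in X / _]mulrA poch_conj !natr_complex.
have -> : - (n%:R : R)%:C = (- n%:R)%:C by rewrite rmorphN.
have -> : (n%:R : R)%:C + p%:C + u%:C + v%:C + d%:C - 1 =
    (n%:R + (p + u + v + d) - 1)%:C.
  by rewrite rmorphB !rmorphD/= rmorph1 !addrA.
rewrite -!rmorphD/= !poch_real /wilson_coef -fmorphV -!rmorphM/=.
by congr (_%:C); ring.
Qed.

(** Multiplication by [(p + k)^2 + s^2] acts on the products attached to [u]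
    as [s^2 + (u + j)^2], a shift of index, plus a constant. *)
Lemma sumsq_prod_basis u k p :
  exists c : nat -> R, forall s, sumsq_prod k p s = \sum_(j < k.+1) c j * sumsq_prod j u s.
Proof.
elim: k => [|k [c Hc]].
  by exists (fun=> 1) => s; rewrite big_ord1 mul1r /sumsq_prod !big_ord0.
pose c' j := if (j < k.+1)%N then c j else 0.
exists (fun j => (if j is i.+1 then c' i else 0) + ((p + k%:R) ^+ 2 - (u + j%:R) ^+ 2) * c' j) => s.
rewrite sumsq_prodSr Hc mulr_suml.
under [RHS]eq_bigr do rewrite mulrDl.
rewrite big_split/= [X in _ = X + _]big_ord_recl/= mul0r add0r [X in _ = _ + X]big_ord_recr/=.
have -> : c' k.+1 = 0 by rewrite /c' ltnn.
rewrite mulr0 mul0r addr0 -big_split/=; apply: eq_bigr => j _.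
by rewrite /bump leq0n add1n /c' ltn_ord sumsq_prodSr; ring.
Qed.

Lemma sum_sumsq_prod_basis u n p (a : nat -> R) :
  exists c : nat -> R, forall s, \sum_(i < n.+1) a i * sumsq_prod i p s =
    \sum_(j < n.+1) c j * sumsq_prod j u s.
Proof.
elim: n => [|n [c Hc]].
  by exists a => s; rewrite !big_ord1 /sumsq_prod !big_ord0.
have [d Hd] := sumsq_prod_basis u n.+1 p.
exists (fun j => (if (j < n.+1)%N then c j else 0) + a n.+1 * d j) => s.
rewrite big_ord_recr/= Hc Hd mulr_sumr.
under [RHS]eq_bigr do rewrite mulrDl.
rewrite big_split/= [X in _ = X + _]big_ord_recr/= ltnn mul0r addr0; congr (_ + _).
  by apply: eq_bigr => j _; rewrite ltn_ord.
by apply: eq_bigr => j _; rewrite mulrA.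
Qed.

(** Only the product of [p] changes, by one factor at each step. *)
Lemma weight_sumsq p u v q k s : 0 < p -> 0 < u -> 0 < v ->
  weight p u v q s * sumsq_prod k p s = poch p k ^+ 2 * weight (p + k%:R) u v q s.
Proof.
move=> p0 u0 v0; elim: k => [|k IH].
  by rewrite /sumsq_prod /poch !big_ord0 addr0 expr1n mulr1 mul1r.
rewrite sumsq_prodSr mulrA IH pochS -natr1 addrA.
have pk : 0 < p + k%:R by rewrite ltr_wpDr.
set a := p + k%:R in pk *.
rewrite /weight (glim_shift s pk).
have a1 : 0 < a + 1 by rewrite addr_gt0.
have h : a ^+ 2 + s ^+ 2 != 0.
  by rewrite gt_eqF// ltr_wpDr ?sqr_ge0// exprn_gt0.
have -> : 1 + s ^+ 2 / a ^+ 2 = (a ^+ 2 + s ^+ 2) / a ^+ 2.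
  by rewrite mulrDl divff// gt_eqF// exprn_gt0.
rewrite exprMn; have a20 : a ^+ 2 != 0 by rewrite gt_eqF// exprn_gt0.
move: h a20 (gt_eqF (glim_gt0 s a1)) (gt_eqF (glim_gt0 s v0)) (gt_eqF (glim_gt0 s u0)).
move: (a ^+ 2 + s ^+ 2) (a ^+ 2) (glim (a + 1) s) (glim u s) (glim v s).
by move=> x y z w t x0 y0 z0 w0 t0; field; rewrite x0 y0 z0 w0 t0.
Qed.

Lemma weightC p u v q s : weight p u v q s = weight u p v q s.
Proof. by rewrite /weight [glim p s * _]mulrC. Qed.

Lemma weight_sumsq2 p u v q i j s : 0 < p -> 0 < u -> 0 < v ->
  weight p u v q s * sumsq_prod i p s * sumsq_prod j u s =
  (poch p i ^+ 2 * poch u j ^+ 2) * weight (p + i%:R) (u + j%:R) v q s.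
Proof.
move=> p0 u0 v0; rewrite weight_sumsq// -[LHS]mulrA [weight (p + _) _ _ _ _]weightC weight_sumsq//.
  by rewrite mulrA [weight (u + _) _ _ _ _]weightC.
by rewrite ltr_wpDr.
Qed.

Let mD : measurable (`[0, +oo[%classic : set R). Proof. exact: measurable_itv. Qed.

Lemma integrable_scale (c : R) (f : R -> R) :
  mu.-integrable `[0, +oo[ (EFin \o f) ->
  mu.-integrable `[0, +oo[ (EFin \o (fun s => c * f s)).
Proof.
move=> If; rewrite (_ : _ \o _ = fun s => (c%:E * (EFin \o f) s)%E); last first.
  by apply/funext => s /=; rewrite EFinM.
exact: integrableZl.
Qed.

(** Integrability and the value of the integral are proved together, since the
    induction step for the latter needs the former. *)
Lemma Rintegral_lincomb n (c : nat -> R) (g : nat -> R -> R) :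
    (forall i, (i < n)%N -> mu.-integrable `[0, +oo[ (EFin \o g i)) ->
  mu.-integrable `[0, +oo[ (EFin \o (fun s => \sum_(i < n) c i * g i s)) /\
  \int[mu]_(s in `[0, +oo[) (\sum_(i < n) c i * g i s) =
  \sum_(i < n) c i * \int[mu]_(s in `[0, +oo[) g i s.
Proof.
elim: n => [|n IH] Ig.
  rewrite big_ord0 (_ : (fun s : R => _) = cst 0); last first.
    by apply/funext => s; rewrite big_ord0.
  by split; [exact: integrable0|rewrite Rintegral_cst// mul0r].
have [I1 E1] := IH (fun i lin => Ig i (ltnW lin)).
have I2 := integrable_scale (c n) (Ig n (ltnSn n)).
rewrite (_ : (fun s : R => _) =
    fun s => \sum_(i < n) c i * g i s + c n * g n s); last first.
  by apply/funext => s; rewrite big_ord_recr.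
split; last by rewrite RintegralD// E1 big_ord_recr/= RintegralZl//; exact: Ig.
rewrite (_ : _ \o _ = ((EFin \o (fun s => \sum_(i < n) c i * g i s)%R) \+
  (EFin \o (fun s => c n * g n s)%R))%E); last exact/funext.
exact: integrableD.
Qed.

Definition moment p u v q i j : R :=
  \int[mu]_(s in `[0, +oo[)
    (weight p u v q s * sumsq_prod i p s * sumsq_prod j u s).

Lemma integrable_moment p u v q i j : 0 < p -> 0 < u -> 0 < v ->
    3 + i%:R + j%:R <= q - p - u - v ->
  mu.-integrable `[0, +oo[
    (EFin \o (fun s => weight p u v q s * sumsq_prod i p s * sumsq_prod j u s)).
Proof.
move=> p0 u0 v0 hq.
have pi0 : 0 < p + i%:R by rewrite ltr_wpDr.
have uj0 : 0 < u + j%:R by rewrite ltr_wpDr.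
have Iw : mu.-integrable `[0, +oo[ (EFin \o weight (p + i%:R) (u + j%:R) v q).
  by apply: integrable_weight => //; lra.
have := integrable_scale (poch p i ^+ 2 * poch u j ^+ 2) Iw.
by congr (_.-integrable _ (_ \o _)); apply/funext => s; rewrite weight_sumsq2.
Qed.

(** The first moment relation at [a = p + i] and [b = u + j], whose polynomial
    is also [(a + b)(a + v)(q - 1 - a) - (q - 1 - a - b - v)(a^2 + s^2)]. *)
Lemma moment_recurrence p u v q i j : 0 < p -> 0 < u -> 0 < v ->
    5 + i%:R + j%:R <= q - p - u - v ->
  moment p u v q i.+1 j * (p + u + v + (1 - q) + j%:R + i%:R) =
  (p + u + j%:R + i%:R) * (p + v + i%:R) * (p + (1 - q) + i%:R) * moment p u v q i j.
Proof.
move=> p0 u0 v0 hq.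
have I1 : mu.-integrable `[0, +oo[
    (EFin \o (fun s => weight p u v q s * sumsq_prod i p s * sumsq_prod j u s)).
  by apply: integrable_moment => //; lra.
have I2 : mu.-integrable `[0, +oo[
    (EFin \o (fun s => weight p u v q s * sumsq_prod i.+1 p s * sumsq_prod j u s)).
  by apply: integrable_moment => //; rewrite -(@natr1 _ i); lra.
pose a := p + i%:R; pose b := u + j%:R.
have a0 : 0 < a by rewrite ltr_wpDr.
have b0 : 0 < b by rewrite ltr_wpDr.
have hab : 5 <= q - a - b - v by rewrite /a /b; lra.
have K := integral_weight_moment a0 b0 v0 hab.
pose k := poch p i ^+ 2 * poch u j ^+ 2.
have poch_gt0 x l : 0 < x -> 0 < poch x l.
  by move=> x0; rewrite /poch prodr_gt0// => t _; rewrite ltr_wpDr.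
have k0 : k != 0 by rewrite mulf_neq0// gt_eqF// exprn_gt0// poch_gt0.
pose Y := q - 1 - a - b - v; pose Z := (a + b) * (a + v) * (q - 1 - a).
pose f s := Z * (weight p u v q s * sumsq_prod i p s * sumsq_prod j u s).
pose g s := Y * (weight p u v q s * sumsq_prod i.+1 p s * sumsq_prod j u s).
have If : mu.-integrable `[0, +oo[ (EFin \o f) by exact: integrable_scale.
have Ig : mu.-integrable `[0, +oo[ (EFin \o g) by exact: integrable_scale.
have Ifg : mu.-integrable `[0, +oo[ (EFin \o (fun s => f s - g s)).
  rewrite (_ : _ \o _ = ((EFin \o f) \- (EFin \o g))%E); last exact/funext.
  exact: integrableB.
have fgE : (fun s => weight a b v q s *
    ((a * b + a * v + b * v) * (q - 1) - a * b * v - Y * s ^+ 2)) =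
    (fun s => k^-1 * (f s - g s)).
  apply/funext => s; apply: (mulfI k0); rewrite mulVKf//.
  rewrite mulrA -weight_sumsq2// /f /g sumsq_prodSr -/a /Z /Y.
  by ring.
move: K; rewrite fgE RintegralZl// RintegralB// !RintegralZl//.
move=> /eqP; rewrite mulf_eq0 invr_eq0 (negbTE k0)/= subr_eq0 => /eqP.
rewrite -/(moment p u v q i j) -/(moment p u v q i.+1 j) => E.
apply: oppr_inj; transitivity (Y * moment p u v q i.+1 j).
  by rewrite /Y /a /b; ring.
by rewrite -E /Z /a /b; ring.
Qed.

Lemma momentE p u v q i j (n : nat) : 0 < p -> 0 < u -> 0 < v ->
    4 * n%:R < q - p - u - v - 1 -> (j < n)%N -> (i <= n)%N ->
  moment p u v q i j * poch (p + u + v + (1 - q) + j%:R) i =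
  poch (p + u + j%:R) i * poch (p + v) i * poch (p + (1 - q)) i * moment p u v q 0 j.
Proof.
move=> p0 u0 v0 hq jn; elim: i => [|i IH] lin.
  by rewrite /poch !big_ord0 !mulr1 mul1r.
rewrite !pochS mulrCA mulrC -mulrA mulrC.
transitivity (moment p u v q i.+1 j * (p + u + v + (1 - q) + j%:R + i%:R) *
  poch (p + u + v + (1 - q) + j%:R) i); first by ring.
rewrite moment_recurrence//; last first.
  have : j%:R + 1 <= n%:R :> R by rewrite natr1 ler_nat.
  have : i%:R + 1 <= n%:R :> R by rewrite natr1 ler_nat.
  have : 0 <= j%:R :> R by [].
  lra.
by rewrite -mulrA IH 1?ltnW//; ring.
Qed.

(** After inserting [momentE], the factors in [p + v] and [p + 1 - q] combine
    with those of the coefficients into constants, and what remains is the sum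
    of [saalschutz_zero]. No denominator vanishes, because [p + u + v + 1 - q]
    is less than [-4n]. *)
Lemma wilson_moment_eq0 p u v q j (n : nat) : 0 < p -> 0 < u -> 0 < v ->
    4 * n%:R < q - p - u - v - 1 -> (j < n)%N ->
  \sum_(i < n.+1) wilson_coef n p u v (1 - q) i * moment p u v q i j = 0.
Proof.
move=> p0 u0 v0 hq jn.
pose y := p + u + v + (1 - q).
have jn1 : j%:R + 1 <= n%:R :> R by rewrite natr1 ler_nat.
have j0 : 0 <= j%:R :> R by [].
have yj i : (i <= n)%N -> poch (y + j%:R) i != 0.
  move=> lin; apply/prodf_neq0 => l _; rewrite lt_eqF//.
  have : l%:R <= n%:R :> R by rewrite ler_nat (leq_trans (ltnW (ltn_ord l)) lin).
  by rewrite /y; lra.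
have x0 k : poch (p + u) k != 0.
  by apply/prodf_neq0 => l _; rewrite gt_eqF// ltr_wpDr// addr_gt0.
have f0 i : (i <= n)%N -> i`!%:R != 0 :> R.
  by rewrite pnatr_eq0 -lt0n fact_gt0.
have S := saalschutz_zero jn x0 yj f0.
transitivity (poch (p + v) n * poch (p + (1 - q)) n * moment p u v q 0 j *
  \sum_(i < n.+1) poch (- n%:R) i * poch (n%:R + y - 1) i / i`!%:R *
     poch (p + u + i%:R) (n - i) * poch (p + u + j%:R) i / poch (y + j%:R) i);
  last by rewrite S mulr0.
rewrite mulr_sumr; apply: eq_bigr => i _.
have lin : (i <= n)%N by rewrite -ltnS.
have M := momentE p0 u0 v0 hq jn lin.
have -> : moment p u v q i j = poch (p + u + j%:R) i * poch (p + v) i *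
    poch (p + (1 - q)) i * moment p u v q 0 j / poch (y + j%:R) i.
  by rewrite -M mulfK// yj.
have E (x : R) : poch x n = poch x i * poch (x + i%:R) (n - i).
  by rewrite -pochD subnKC.
rewrite /wilson_coef !E -/y; ring.
Qed.

(** The polynomial of degree [n] is kept in the products attached to [p] and
    the one of degree [m] is rewritten in those attached to [u]; each product
    [j <= m < n] then gives zero. *)
Lemma wilson_orthogonal_lt p u v q (n m : nat) : 0 < p -> 0 < u -> 0 < v -> 0 < q -> (m < n)%N ->
    4 * n%:R < q - p - u - v - 1 ->
  let P k s := wilson k p%:C u%:C v%:C (1 - q)%:C s in
  let f s := P n s * P m s * (w1 p u v q s)%:C in
  cintegrable `[0, +oo[ f /\ cintegral `[0, +oo[ f = 0.
Proof.
move=> p0 u0 v0 q0 mn hn P f.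
have [K HK] := w1_weight p0 u0 v0 q0.
have [c Hc] := sum_sumsq_prod_basis u m p (wilson_coef m p u v (1 - q)).
pose T j s := \sum_(i < n.+1) wilson_coef n p u v (1 - q) i *
  (weight p u v q s * sumsq_prod i p s * sumsq_prod j u s).
have IT j : (j < n)%N ->
  mu.-integrable `[0, +oo[ (EFin \o T j) /\ \int[mu]_(s in `[0, +oo[) T j s = 0.
  move=> jn.
  have [i lin|IT ET] := @Rintegral_lincomb n.+1 (wilson_coef n p u v (1 - q))
    (fun i s => weight p u v q s * sumsq_prod i p s * sumsq_prod j u s).
    apply: integrable_moment => //.
    have : j%:R + 1 <= n%:R :> R by rewrite natr1 ler_nat.
    have : i%:R <= n%:R :> R by rewrite ler_nat.
    have : 0 <= j%:R :> R by [].
    lra.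
  by split; [exact: IT|rewrite /T ET; exact: wilson_moment_eq0].
have [j jm|IF EF] := @Rintegral_lincomb m.+1 c T.
  by have [] := IT j (leq_trans jm mn).
pose F s := K * \sum_(j < m.+1) c j * T j s.
have IF' : mu.-integrable `[0, +oo[ (EFin \o F) by exact: integrable_scale.
have EF' : \int[mu]_(s in `[0, +oo[) F s = 0.
  rewrite /F RintegralZl// EF big1 ?mulr0// => j _.
  by have [_ ->] := IT j (leq_trans (ltn_ord j) mn); rewrite mulr0.
have fE s : f s = (F s)%:C.
  rewrite /f /P !wilsonE Hc HK -!rmorphM/=; congr (_%:C).
  set A := \sum_(i < n.+1) _; set B := \sum_(j < m.+1) _.
  have TE j : T j s = weight p u v q s * A * sumsq_prod j u s.
    rewrite /T mulr_sumr mulr_suml; apply: eq_bigr => i _.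
    by ring.
  have -> : F s = K * (weight p u v q s * A * B).
    rewrite /F; congr (_ * _); rewrite /B mulr_sumr; apply: eq_bigr => j _.
    by rewrite TE mulrCA.
  by ring.
rewrite /cintegrable /cintegral.
have -> : (fun s => (complex.Re (f s))%:E) = EFin \o F by apply/funext => s /=; rewrite fE.
have -> : (fun s => (complex.Im (f s))%:E) = cst 0%E by apply/funext => s /=; rewrite fE.
split; first by split => //; exact: integrable0.
under eq_Rintegral do rewrite fE /=.
under [X in _ +i* X]eq_Rintegral do rewrite fE /=.
by rewrite EF' Rintegral_cst// mul0r.
Qed.

End WilsonReal.

Theorem mainTheorem2 (R : realType) (p u v q : R)
    (p_gt0 : 0 < p) (u_gt0 : 0 < u) (v_gt0 : 0 < v) (q_gt0 : 0 < q)
    (n m : nat) (neq_nm : n <> m)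
    (n_small : 4 * n%:R < q - p - u - v - 1)
    (m_small : 4 * m%:R < q - p - u - v - 1) :
  let P k s := wilson k p%:C u%:C v%:C (1 - q)%:C s in
  let f s := P n s * P m s * (w1 p u v q s)%:C in
  cintegrable `[0, +oo[ f /\ cintegral `[0, +oo[ f = 0.
Proof.
have [mn|nm|/esym/neq_nm//] := ltngtP m n; first exact: wilson_orthogonal_lt.
move=> P f; rewrite (_ : f = fun s => P m s * P n s * (w1 p u v q s)%:C).
  exact: wilson_orthogonal_lt.
by apply/funext => s; rewrite /f [P n s * _]mulrC.
Qed.
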